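(* Let $k\geq 3$ be an integer and $0<\varepsilon<1$ a constant, and set $Q(k,\varepsilon)=(320k^4)^{k+1}/\varepsilon^{2k}$ and $a_k=\binom{k}{2}-k$. (i) If $q\geq Q(k,\varepsilon)$ is an even prime power and $t$ is an integer with $0\leq t\leq (1-\varepsilon)q$ and $t\neq 1$, then $r\big(C_4,B^{(k)}_{q^2-kq+t+a_k}\big)=q^2+t$. (ii) If $q\geq Q(k,\varepsilon)$ is an odd prime power and $t$ is an integer such that either $q\equiv 3\pmod 4$, $\tfrac{q+1}{2}\leq t\leq (1-\varepsilon)q$ and $t\neq\tfrac{q+3}{2}$; or $q\equiv 1\pmod 4$, $\tfrac{q-1}{2}\leq t\leq (1-\varepsilon)q$ and $t\neq \tfrac{q+1}{2}$, then $r\big(C_4,B^{(k)}_{q^2-kq+t+a_k}\big)=q^2+t$.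
   Context: For graphs $H_1,H_2$, the Ramsey number $r(H_1,H_2)$ is the smallest integer $N$ such that for every graph $G$ on $N$ vertices, either $G$ contains $H_1$ as a subgraph or the complement $\overline{G}$ contains $H_2$ as a subgraph. $C_4$ is the cycle on 4 vertices. For positive integers $n,k$, the book graph $B_n^{(k)}$ consists of $n$ copies of $K_{k+1}$ all sharing a common $K_k$. *)

(* Defs.v *)
From HB Require Import structures.
From mathcomp Require Import all_boot all_order all_algebra.
From mathcomp Require Import reals.

Set Implicit Arguments.
Unset Strict Implicit.
Unset Printing Implicit Defensive.

Import GRing.Theory Num.Theory.

Record sgraph := SGraph {
  vertex :> finType;
  adj : rel vertex;
  adj_sym : symmetric adj;
  adj_irr : irreflexive adj
}.

Definition compl_adj (G : sgraph) : rel G :=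
  fun x y => (x != y) && ~~ adj x y.

Lemma compl_adj_sym (G : sgraph) : symmetric (@compl_adj G).
Proof. by move=> x y; rewrite /compl_adj eq_sym adj_sym. Qed.

Lemma compl_adj_irr (G : sgraph) : irreflexive (@compl_adj G).
Proof. by move=> x; rewrite /compl_adj eqxx. Qed.

Definition compl_graph (G : sgraph) : sgraph :=
  SGraph (@compl_adj_sym G) (@compl_adj_irr G).

(* H is a (not necessarily induced) subgraph of G, up to isomorphism. *)
Definition contains_subgraph (G H : sgraph) : Prop :=
  exists f : H -> G,
    injective f /\ forall x y : H, adj x y -> adj (f x) (f y).

Definition ramsey_prop (H1 H2 : sgraph) (N : nat) : Prop :=
  forall G : sgraph, #|G| = N ->
    contains_subgraph G H1 \/ contains_subgraph (compl_graph G) H2.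

(* r(H1, H2) = N *)
Definition is_ramsey_number (H1 H2 : sgraph) (N : nat) : Prop :=
  ramsey_prop H1 H2 N /\ forall M : nat, ramsey_prop H1 H2 M -> N <= M.

Definition C4_adj : rel 'I_4 :=
  fun i j => (j == i.+1 %% 4 :> nat) || (i == j.+1 %% 4 :> nat).

Lemma C4_adj_sym : symmetric C4_adj.
Proof. by move=> i j; rewrite /C4_adj orbC. Qed.

Lemma C4_adj_irr : irreflexive C4_adj.
Proof. by case; do 4?case. Qed.

Definition C4 : sgraph := SGraph C4_adj_sym C4_adj_irr.

(* The common K_k is the set of vertices inl i; the j-th copy of K_{k+1} is the
   common K_k together with inr j. *)
Definition book_adj (k n : nat) : rel ('I_k + 'I_n)%type :=
  fun u v => match u, v with
  | inl i, inl i' => i != i'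
  | inl _, inr _ | inr _, inl _ => true
  | inr _, inr _ => false
  end.

Lemma book_adj_sym (k n : nat) : symmetric (@book_adj k n).
Proof. by case=> i [] j //=; rewrite eq_sym. Qed.

Lemma book_adj_irr (k n : nat) : irreflexive (@book_adj k n).
Proof. by case=> i //=; rewrite eqxx. Qed.

Definition book (k n : nat) : sgraph :=
  SGraph (@book_adj_sym k n) (@book_adj_irr k n).

Definition prime_power (q : nat) : Prop :=
  exists p m : nat, [/\ prime p, 0 < m & q = p ^ m].

(* For k >= 3 we have k <= 'C(k, 2), so the subtraction is exact. *)
Definition a_ (k : nat) : nat := 'C(k, 2) - k.

(* The index q^2 - kq + t + a_k; the subtraction is exact when k <= q, which
   q >= Q(k, eps) guarantees for k >= 3. *)
Definition book_size (k q t : nat) : nat := q ^ 2 - k * q + t + a_ k.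

Definition Qbound (R : realType) (k : nat) (eps : R) : R :=
  ((320%:R * k%:R ^+ 4) ^+ k.+1 / eps ^+ (2 * k))%R.

(* Main.v *)
Require Import Defs.
From HB Require Import structures.
From mathcomp Require Import all_boot all_order all_fingroup all_algebra.
From mathcomp Require Import all_solvable all_field.
From mathcomp Require Import reals zify ring.

Set Implicit Arguments.
Unset Strict Implicit.
Unset Printing Implicit Defensive.

Import Order.TTheory GRing.Theory Num.Theory.

(** A graph has a book B_n^(k) in its complement iff some independent k-set [S]
    leaves [n] vertices outside [S] and its neighbourhood; with the parameters of
    the theorem the threshold for the size of the neighbourhood is
    kq - 'C(k, 2).

    Upper bound. In a C4-free graph on q^2 + t vertices, either there are many
    vertices of degree at most q - (k - 1) / 2, and k independent ones suffice, or
    almost all degrees are at least q - k.  In the second case C4-freeness forces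
    all degrees to be O(q), and all but O(q) vertices to have a common neighbour
    with a given one; counting cherries, t <= (1 - eps) q leaves more than
    O(k^3 q) vertices of degree at most q.  Among these one picks greedily k
    independent vertices that pairwise have common neighbours, all distinct, so
    that their neighbourhoods cover at most kq - 'C(k, 2) vertices.

    Lower bound. By Bonferroni a C4-free graph on q^2 + t - 1 vertices with minimum
    degree at least q suffices.  It is obtained from a polarity graph of
    PG(2, q) by deleting m = q + 2 - t points.  For even q these lie on the polar
    line of an absolute point (or are all absolute points and their pole).  For odd
    q one deletes a point [p], the absolute points of its polar line, and
    conjugate pairs {x, x'} of internal points of this line, which accounts for odd
    m.  For even m one deletes one more internal point x, adds an edge from x' to
    another internal point y of the polar line of [p], and deletes the
    edges joining the polar lines of x' and y. *)

(** * Books and C4-free graphs *)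

Definition nbrs (G : sgraph) (x : G) : {set G} := [set y | adj x y].

(** Counting form of having no 4-cycle; the two lemmas below relate it to
    [contains_subgraph G C4]. *)
Definition C4free (G : sgraph) : Prop :=
  forall x y : G, x != y -> #|nbrs x :&: nbrs y| <= 1.

Definition independent (G : sgraph) (S : {set G}) : Prop :=
  {in S &, forall x y, ~~ adj x y}.

Lemma C4free_dec (G : sgraph) : C4free G \/ contains_subgraph G C4.
Proof.
have [/forallP h|] := boolP [forall x : G, forall y : G,
    (x != y) ==> (#|nbrs x :&: nbrs y| <= 1)].
  by left=> x y xy; move/forallP: (h x) => /(_ y) /implyP; apply.
move=> /forallPn[x /forallPn[y]]; rewrite negb_imply -ltnNge.
case/andP=> xy /card_gt1P[u [v []]]; rewrite !inE.
move=> /andP[xu yu] /andP[xv yv] uv; right.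
exists (fun i : 'I_4 => nth x [:: x; u; y; v] i).
have neq (a b : G) : adj a b -> a != b.
  by apply: contraTneq => ->; rewrite adj_irr.
have un : uniq [:: x; u; y; v].
  by rewrite /= !inE !negb_or (neq _ _ xu) xy (neq _ _ xv) eq_sym (neq _ _ yu) uv
    (neq _ _ yv).
split.
  by move=> i j /eqP; rewrite nth_uniq // => /eqP/val_inj.
by case; do 4?case=> //; move=> ? []; do 4?case=> //;
  rewrite /= /C4_adj /= ?xu ?yu ?xv ?yv // => _ _; rewrite adj_sym.
Qed.

Lemma C4free_not_contains (G : sgraph) : C4free G -> ~ contains_subgraph G C4.
Proof.
move=> fr [f [finj fadj]].
have i0 : 0 < 4 by []. have i1 : 1 < 4 by []. have i2 : 2 < 4 by []. have i3 : 3 < 4 by [].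
pose o0 := Ordinal i0; pose o1 := Ordinal i1; pose o2 := Ordinal i2; pose o3 := Ordinal i3.
have : #|nbrs (f o0) :&: nbrs (f o2)| <= 1.
  by apply: fr; apply/eqP => /finj.
rewrite leqNgt => /negP; apply; apply/card_gt1P.
exists (f o1), (f o3); rewrite !inE; split; last by apply/eqP => /finj.
  by rewrite !fadj.
by rewrite !fadj.
Qed.

Lemma contains_book (G : sgraph) (k n : nat) (S T : {set G}) :
  independent S -> k = #|S| -> n <= #|T| -> [disjoint S & T] ->
  {in S & T, forall x y, ~~ adj x y} ->
  contains_subgraph (compl_graph G) (book k n).
Proof.
move=> indS ck nT dis noST; subst k.
have ST (i : 'I_#|S|) (j : 'I_n) : enum_val i != enum_val (widen_ord nT j).
  apply/eqP => e; move/pred0P: dis => /(_ (enum_val i)) /=.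
  by rewrite {2}e !enum_valP.
exists (fun u => match u with
  | inl i => enum_val i
  | inr j => enum_val (widen_ord nT j) end); split.
  move=> [i|i] [j|j] /=.
  - by move/enum_val_inj->.
  - by move/eqP; rewrite (negPf (ST _ _)).
  - by move/eqP; rewrite eq_sym (negPf (ST _ _)).
  - by move/enum_val_inj => /(congr1 val) /= /val_inj ->.
move=> [i|i] [j|j] //=; rewrite /compl_adj.
- move=> ij; rewrite indS ?enum_valP // andbT.
  by apply: contra ij => /eqP/enum_val_inj ->.
- by rewrite ST noST ?enum_valP.
- by rewrite eq_sym ST adj_sym noST ?enum_valP.
Qed.

(** The spine [S], the pages [T] and the union of the neighbourhoods of [S] are pairwise disjoint,
    and the union has at least kq - 'C(k, 2) vertices, which is too much for [G]. *)
Lemma not_contains_book (G : sgraph) (k n q : nat) :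
  C4free G -> (forall x : G, q <= #|nbrs x|) ->
  #|G| + 'C(k, 2) < k * q + k + n ->
  ~ contains_subgraph (compl_graph G) (book k n).
Proof.
move=> fr dmin szG [f [finj fadj]].
pose S : {set G} := [set f (inl i) | i : 'I_k].
pose T : {set G} := [set f (inr j) | j : 'I_n].
have cS : #|S| = k by rewrite card_imset ?card_ord // => i j /finj [].
have cT : #|T| = n by rewrite card_imset ?card_ord // => i j /finj [].
(* Bonferroni: two neighbourhoods share at most one vertex *)
have bonf (s : seq G) : uniq s ->
    size s * q <= #|\bigcup_(x <- s) nbrs x| + 'C(size s, 2).
  elim: s => [|x s IH] //= /andP[xs us].
  rewrite big_cons binS bin1; have := IH us.
  set U := \bigcup_(_ <- _) _ => IHs.
  have : #|nbrs x :&: U| <= size s.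
    rewrite /U => {IH us IHs}; elim: s xs {U} => [|y s IH]; first by rewrite big_nil setI0 cards0.
    rewrite inE negb_or => /andP[xy xs]; rewrite big_cons setIUr.
    apply: leq_trans (leq_card_setU _ _) _.
    by have := fr _ _ xy; have := IH xs; rewrite /=; lia.
  have := cardsUI (nbrs x) U; have := dmin x.
  by rewrite mulSn; lia.
have := bonf (enum S) (enum_uniq _); rewrite -cardE cS.
set U := \bigcup_(_ <- _) _ => bU.
have Uin y : y \in U -> exists2 x, x \in S & adj x y.
  by rewrite /U big_enum /= => /bigcupP[x xS]; rewrite inE => xy; exists x.
have d1 : S :&: T = set0.
  apply/setP => z; rewrite !inE; apply/negP => /andP[/imsetP[i _ ->] /imsetP[j _] /finj].
  by [].
have d2 : (S :|: T) :&: U = set0.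
  apply/setP => z; rewrite in_setI in_set0; apply/negP => /andP[zST /Uin [x /imsetP[i _ ->]]].
  case/setUP: zST => /imsetP[j _ ->].
    have [->|ij] := eqVneq i j; first by rewrite adj_irr.
    by have /andP[_ /negPf ->] := fadj (inl i) (inl j) ij.
  by have /andP[_ /negPf ->] := fadj (inl i) (inr j) isT.
have := cardsUI S T; rewrite d1 cards0.
have := cardsUI (S :|: T) U; rewrite d2 cards0.
have : #|(S :|: T) :|: U| <= #|G| by apply: max_card.
by rewrite cS cT; lia.
Qed.

(** * The upper bound *)

Lemma greedy_set (T : finType) (P : {set T} -> Prop) (k : nat) :
  P set0 ->
  (forall S : {set T}, P S -> #|S| < k -> exists2 v, v \notin S & P (v |: S)) ->
  exists2 S : {set T}, #|S| = k & P S.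
Proof.
move=> P0 step.
suff h i : i <= k -> exists2 S : {set T}, #|S| = i & P S by apply: h.
elim: i => [|i IH] ik; first by exists set0; rewrite ?cards0.
have [S cS PS] := IH (ltnW ik).
have [|v vS Pv] := step S PS; first by rewrite cS.
by exists (v |: S); rewrite // cardsU1 vS cS.
Qed.

Lemma setD_nonempty (T : finType) (A B : {set T}) :
  #|B| < #|A| -> exists2 v, v \in A & v \notin B.
Proof.
move=> h; have : 0 < #|A :\: B|.
  have := cardsID B A; have := subset_leq_card (subsetIr A B); lia.
by case/card_gt0P => v; rewrite inE => /andP[vB vA]; exists v.
Qed.

Lemma leq_card_bigcup (I T : finType) (S : {set I}) (F : I -> {set T}) (b : nat) :
  (forall i, i \in S -> #|F i| <= b) -> #|\bigcup_(i in S) F i| <= #|S| * b.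
Proof.
move=> h; rewrite -sum_nat_const.
elim/big_rec2: _ => [|i n B iS IH]; first by rewrite cards0.
by apply: leq_trans (leq_card_setU _ _) _; rewrite leq_add ?h.
Qed.

(** Greedy choice: each chosen vertex rules out itself and at most [b] others of [A]. *)
Lemma independent_of_degree (G : sgraph) (A : {set G}) (b k : nat) :
  (forall v, v \in A -> #|nbrs v :&: A| <= b) -> k * b.+1 <= #|A| ->
  exists2 S : {set G}, #|S| = k & S \subset A /\ independent S.
Proof.
move=> hb hA.
apply: (greedy_set (P := fun S : {set G} => S \subset A /\ independent S)).
  by split; rewrite ?sub0set // => x y; rewrite inE.
move=> S [SA indS] Sk.
have hF s : s \in S -> #|s |: (nbrs s :&: A)| <= b.+1.
  by move=> sS; rewrite cardsU1 !inE adj_irr /= add1n; apply/hb/(subsetP SA).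
have [|v vA vB] := setD_nonempty (A := A) (B := \bigcup_(s in S) (s |: (nbrs s :&: A))).
  apply: leq_ltn_trans (leq_card_bigcup hF) _.
  by apply: leq_trans hA; rewrite ltn_mul2r.
have vsep s : s \in S -> (v != s) && ~~ adj s v.
  move=> sS; rewrite -negb_or; apply: contra vB => h; apply/bigcupP; exists s => //.
  by rewrite !inE vA andbT.
exists v; first by apply/negP => /vsep; rewrite eqxx.
split; first by rewrite subUset sub1set vA.
move=> x y /setU1P[->|xS] /setU1P[->|yS].
- by rewrite adj_irr.
- by rewrite adj_sym; case/andP: (vsep _ yS).
- by case/andP: (vsep _ xS).
- exact: indS.
Qed.

(** If some vertex of [A] has 2k neighbours in [A], these induce degrees at most 1 by C4-freeness;
    otherwise all degrees within [A] are below 2k. The greedy bound applies in both cases. *)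
Lemma C4free_independent (G : sgraph) (A : {set G}) (k : nat) :
  C4free G -> 2 * k ^ 2 <= #|A| ->
  exists2 S : {set G}, #|S| = k & S \subset A /\ independent S.
Proof.
move=> fr hA.
have [/existsP[v /andP[vA hv]]|/existsPn small] :=
    boolP [exists v, (v \in A) && (2 * k <= #|nbrs v :&: A|)].
  have [||S cS [SA indS]] := @independent_of_degree G (nbrs v :&: A) 1 k.
  - move=> u; rewrite !inE => /andP[vu _].
    apply: leq_trans (fr u v _); last by apply: contraTneq vu => ->; rewrite adj_irr.
    by apply: subset_leq_card; rewrite setIA subsetIl.
  - by rewrite mulnC.
  by exists S => //; split=> //; apply: subset_trans SA (subsetIr _ _).
have [k0|k0] := posnP k.
  by exists set0; rewrite ?cards0 ?k0 //; split; rewrite ?sub0set // => x y; rewrite inE.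
apply: (@independent_of_degree _ _ (2 * k).-1); last first.
  by rewrite prednK ?muln_gt0 // mulnCA mulnn.
by move=> v vA; have := small v; rewrite vA /= -ltnNge; lia.
Qed.

Definition unlinked (G : sgraph) (v : G) : {set G} :=
  [set x | [disjoint nbrs v & nbrs x]].

(** Paths v-u-x with x != v are counted by their end x: C4-freeness allows at most one for each x,
    and an unlinked x has none. *)
Lemma two_step_count (G : sgraph) (v : G) : C4free G ->
  \sum_(u in nbrs v) #|nbrs u|.-1 + #|unlinked v| <= #|G|.
Proof.
move=> fr.
have -> : \sum_(u in nbrs v) #|nbrs u|.-1 =
    \sum_(x : G | x != v) #|nbrs v :&: nbrs x|.
  have e u : u \in nbrs v -> #|nbrs u|.-1 = \sum_(x : G | x != v) (u \in nbrs x).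
    rewrite inE => vu; rewrite (cardsD1 v) inE adj_sym vu /= -sum1_card.
    rewrite big_mkcond [RHS]big_mkcond /=; apply: eq_bigr => x _.
    by rewrite !inE adj_sym; case: (x != v); case: (adj _ _).
  rewrite (eq_bigr _ e) exchange_big /=; apply: eq_bigr => x _.
  rewrite -sum1_card big_mkcond [RHS]big_mkcond /=; apply: eq_bigr => u _.
  by rewrite !inE; case: (adj v u); case: (adj x u).
rewrite -[#|unlinked v|]sum1_card -[#|G|]sum1_card big_mkcond [X in _ + X]big_mkcond -big_split /=.
apply: leq_sum => x _; rewrite inE -setI_eq0.
have [->|xv] := eqVneq x v; first by case: ifP.
have := fr v x; rewrite eq_sym => /(_ xv).
by case: eqP => [->|_]; rewrite ?cards0 ?addn0.
Qed.

(** Sum of the two-step count over all starts [v]; a vertex u is the middle once for each of its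
    neighbours. *)
Lemma cherry_count (G : sgraph) : C4free G ->
  \sum_(v : G) #|nbrs v| * #|nbrs v|.-1 <= #|G| ^ 2.
Proof.
move=> fr.
have -> : \sum_(v : G) #|nbrs v| * #|nbrs v|.-1 =
    \sum_(v : G) \sum_(u in nbrs v) #|nbrs u|.-1.
  rewrite (exchange_big_dep predT) //=; apply: eq_bigr => u _.
  rewrite sum_nat_const; congr (_ * _); apply: eq_card => x.
  by rewrite -[RHS]/(u \in nbrs x) !inE adj_sym.
rewrite -mulnn -sum_nat_const; apply: leq_sum => v _.
by have := two_step_count v fr; lia.
Qed.

Definition nbrsU (G : sgraph) (S : {set G}) : {set G} := \bigcup_(s in S) nbrs s.

Lemma leq_of_sqr_leq (c k q : nat) : 0 < c -> c * k ^ 2 <= q -> k <= q.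
Proof.
move=> c0; apply: leq_trans; rewrite -mulnn; case: k => // k.
by rewrite mulnA leq_pmull // muln_gt0 c0.
Qed.

Section UpperBound.

Variables (G : sgraph) (k q e : nat).
Hypotheses (frG : C4free G) (k_ge3 : 3 <= k) (qk : 10 * k ^ 2 <= q).
Hypotheses (szG_ge : q ^ 2 <= #|G|) (szG_le : #|G| + e <= q ^ 2 + q).
Hypothesis e_big : 20 * k ^ 4 <= e.

Let k_le_q : k <= q := @leq_of_sqr_leq 10 k q isT qk.
(** [D] holds the vertices of degree at most q - (k - 1) / 2: any k of them cover at most kq - 'C(k,
    2) vertices, even without overlaps. In [A] the degree is still at most q, but overlaps are
    needed. *)
Let D : {set G} := [set v | 2 * #|nbrs v| + k <= 2 * q + 1].
Let A : {set G} := [set v | #|nbrs v| <= q] :\: D.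

Lemma deg_notin_D (v : G) : v \notin D -> q < #|nbrs v| + k.
Proof. by rewrite inE -ltnNge; lia. Qed.

(** Outside [D] each term is at least q - k, and fewer than 2k^2 terms are dropped. *)
Lemma sum_degree_lower (B : {set G}) : #|D| < 2 * k ^ 2 ->
  (#|B| - 2 * k ^ 2) * (q - k) <= \sum_(u in B) #|nbrs u|.-1.
Proof.
move=> hD; apply: (@leq_trans (#|B :\: D| * (q - k))).
  have := cardsID D B; have := subset_leq_card (subsetIr B D) => h1 h2.
  by rewrite leq_mul2r; apply/orP; right; lia.
rewrite -sum_nat_const [X in _ <= X](big_setID D) /=.
apply: leq_trans (leq_addl _ _); apply: leq_sum => u; rewrite in_setD => /andP[uD _].
by have := deg_notin_D uD; lia.
Qed.

(** A vertex of degree above 2q would start about 2q^2 two-step paths, more than there are vertices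
    to end them. *)
Lemma max_degree (v : G) : #|D| < 2 * k ^ 2 -> #|nbrs v| <= 2 * q.
Proof.
move=> hD; have := sum_degree_lower (nbrs v) hD; have := two_step_count v frG.
move: szG_le; set d := #|nbrs v|; set s := \sum_(u in _) _; move=> h1 h2 h3.
rewrite leqNgt; apply/negP => hd.
have h4 : (2 * q - 2 * k ^ 2) * (q - k) <= q ^ 2 + q.
  apply: leq_trans (_ : (d - 2 * k ^ 2) * (q - k) <= _); last by lia.
  by rewrite leq_mul2r; apply/orP; right; lia.
(* With q = r + 10K and K = k^2 >= k, the truncated subtractions become exact and a polynomial
   inequality in r and K remains. *)
have [r er] : exists r, q = r + 10 * k ^ 2 by exists (q - 10 * k ^ 2); lia.
have h5 : k <= k ^ 2 by rewrite -mulnn leq_pmulr //; lia.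
set K := k ^ 2 in h4 h5 er *.
have h6 : (2 * q - 2 * K) * (q - K) <= q ^ 2 + q.
  by apply: leq_trans h4; rewrite leq_mul2l; apply/orP; right; lia.
have K0 : 0 < K by lia.
move: h6; rewrite er -mulnn.
have -> : 2 * (r + 10 * K) - 2 * K = 2 * r + 18 * K by lia.
have -> : r + 10 * K - K = r + 9 * K by lia.
have : r <= r * K by rewrite leq_pmulr.
have : K <= K * K by rewrite leq_pmulr.
by move: K0; clear; lia.
Qed.

(** A vertex outside [D] has degree above q - k, so its two-step paths already end in at least (q -
    k - 2k^2)(q - k) vertices. *)
Lemma card_unlinked (v : G) : #|D| < 2 * k ^ 2 -> v \notin D ->
  #|unlinked v| <= 3 * k ^ 2 * q.
Proof.
move=> hD vD; have := sum_degree_lower (nbrs v) hD; have := two_step_count v frG.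
have := deg_notin_D vD.
move: szG_le; set d := #|nbrs v|; set s := \sum_(u in _) _; set n := #|unlinked v|.
move=> h1 h0 h2 h3.
have h5 : k * 3 <= k ^ 2 by rewrite -mulnn leq_mul2l k_ge3 orbT.
set K := k ^ 2 in h3 h5 *.
have h4 : (q - k - 2 * K) * (q - k) + n <= q ^ 2 + q.
  have : (q - k - 2 * K) * (q - k) <= (d - 2 * K) * (q - k).
    by rewrite leq_mul2r; apply/orP; right; lia.
  by lia.
have [r er] : exists r, q = r + k + 2 * K by exists (q - k - 2 * K); lia.
have kK : k * k = K by rewrite mulnn.
move: h4; rewrite er -mulnn.
have -> : r + k + 2 * K - k = r + 2 * K by lia.
rewrite addnK.
have : r * (k * 3) <= r * K by rewrite leq_mul2l h5 orbT.
have : K * (k * 3) <= K * K by rewrite leq_mul2l h5 orbT.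
have : r * 3 <= r * k by rewrite leq_mul2l k_ge3 orbT.
have : K * 3 <= K * k by rewrite leq_mul2l k_ge3 orbT.
by move: k_ge3 kK h5; clear; lia.
Qed.

(** If [A] were small, almost all d(d - 1) would be at least q^2 + q, and the cherry count would
    exceed |G|^2, because |G| stays below q^2 + q by [e]. *)
Lemma card_deg_le_q : #|D| < 2 * k ^ 2 -> 5 * k ^ 3 * q < #|A|.
Proof.
move=> hD; rewrite ltnNge; apply/negP => hA.
(* The deficit of d(d - 1) against (q + 1)q is 0 for d > q, at most 2kq on [A], and bounded
   trivially on [D]. *)
have h1 (v : G) : q ^ 2 + q <= #|nbrs v| * #|nbrs v|.-1 +
    ((v \in D) * (q ^ 2 + q) + (v \in A) * (2 * k * q)).
  have [vD|vD] := boolP (v \in D); first by lia.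
  have := deg_notin_D vD; rewrite !in_setD vD inE.
  set d := #|nbrs v|; case: (leqP d q) => dq h; last first.
    have : q.+1 * q <= d * d.-1 by apply: leq_mul; lia.
    by rewrite -mulnn; lia.
  have [r er] : exists r, q = r + k by exists (q - k); rewrite subnK ?k_le_q.
  have : r.+1 * r <= d * d.-1 by rewrite leq_mul; lia.
  by rewrite er -mulnn /=; move: (d * _) => x; clear; nia.
have h2 : #|G| * (q ^ 2 + q) <= #|G| ^ 2 + (#|D| * (q ^ 2 + q) + #|A| * (2 * k * q)).
  have -> : #|D| * (q ^ 2 + q) + #|A| * (2 * k * q) =
     \sum_(v : G) ((v \in D) * (q ^ 2 + q) + (v \in A) * (2 * k * q)).
    rewrite big_split -!big_distrl /= -!sum1_card.
    by congr (_ * _ + _ * _); rewrite [LHS]big_mkcond; apply: eq_bigr => v _; case: (_ \in _).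
  apply: leq_trans (leq_add (cherry_count frG) (leqnn _)).
  by rewrite -sum_nat_const -big_split; apply: leq_sum => v _; apply: h1.
have h3 : #|G| * e <= 2 * k ^ 2 * (q ^ 2 + q) + 5 * k ^ 3 * q * (2 * k * q).
  have : #|D| * (q ^ 2 + q) <= 2 * k ^ 2 * (q ^ 2 + q) by rewrite leq_mul2r (ltnW hD) orbT.
  have : #|A| * (2 * k * q) <= 5 * k ^ 3 * q * (2 * k * q) by rewrite leq_mul2r hA orbT.
  have : #|G| * (#|G| + e) <= #|G| * (q ^ 2 + q) by rewrite leq_mul2l szG_le orbT.
  by rewrite mulnDr -mulnn; lia.
have h4 : q ^ 2 * e <= #|G| * e by rewrite leq_mul2r szG_ge orbT.
have h5 : q ^ 2 * (20 * k ^ 4) <= q ^ 2 * e by rewrite leq_mul2l e_big orbT.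
have q0 : 0 < q ^ 2 by rewrite expn_gt0; lia.
have : q ^ 2 * (20 * k ^ 4) <= q ^ 2 * (4 * k ^ 2 + 10 * k ^ 4).
  apply: leq_trans h5 (leq_trans h4 (leq_trans h3 _)).
  have : q <= q ^ 2 by rewrite -mulnn leq_pmulr //; lia.
  rewrite (_ : 5 * k ^ 3 * q * (2 * k * q) = 10 * k ^ 4 * q ^ 2).
    move=> qQ; have : k ^ 2 * q <= k ^ 2 * q ^ 2 by rewrite leq_mul2l qQ orbT.
    by clear; move: (q ^ 2) (k ^ 2) (k ^ 4) => Q K L; lia.
  by rewrite !expnS expn0; lia.
rewrite leq_pmul2l // (_ : k ^ 4 = k ^ 2 * k ^ 2); last by rewrite -expnD.
have K9 : 9 <= k ^ 2 by rewrite -[9]/(3 ^ 2) leq_exp2r.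
have : k ^ 2 * 9 <= k ^ 2 * k ^ 2 by rewrite leq_mul2l K9 orbT.
by move: K9; clear; move: (k ^ 2) => K; lia.
Qed.

Lemma small_neighborhood_union :
  exists S : {set G}, [/\ #|S| = k, independent S &
    #|nbrsU S| + 'C(k, 2) <= k * q].
Proof.
have [hD|hD] := leqP (2 * k ^ 2) #|D|.
  have [S cS [SD indS]] := C4free_independent frG hD; exists S; split=> //.
  have : 2 * #|nbrsU S| <= k * (2 * q + 1 - k).
    have h (s : G) : s \in S -> #|nbrs s| <= (2 * q + 1 - k)./2.
      by move/(subsetP SD); rewrite inE; lia.
    have := leq_card_bigcup h; rewrite cS -/(nbrsU S) => h2.
    apply: leq_trans (_ : 2 * (k * (2 * q + 1 - k)./2) <= _); first by rewrite leq_mul2l h2.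
    by rewrite mulnCA leq_mul2l; apply/orP; right; lia.
  have := mul_bin_diag k 1; rewrite bin1.
  have [r er] : exists r, q = r + k by exists (q - k); rewrite subnK ?k_le_q.
  rewrite er (_ : 2 * (r + k) + 1 - k = 2 * r + k + 1); last by lia.
  case: (k) k_ge3 => // k' _ /=; move: #|_| 'C(_, 2) => u b; clear; lia.
(* Invariant of the greedy choice: a new vertex adds at most q neighbours, of which |S| are already
   covered, matching the growth of 'C(|S|, 2) by |S|. *)
pose P (S : {set G}) := [/\ S \subset A, independent S &
  #|nbrsU S| + 'C(#|S|, 2) <= #|S| * q].
suff [S cS [_ indS US]] : exists2 S : {set G}, #|S| = k & P S.
  by exists S; split=> //; rewrite -cS.
apply: greedy_set.
  split=> [|x y|]; [by rewrite sub0set | by rewrite inE |].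
  by rewrite /nbrsU big_set0 !cards0.
move=> S [SA indS US] Sk.
(* [F1 s] excludes vertices adjacent to [s] or sharing no neighbour with it. [F2] excludes the
   neighbours of a common neighbour of two chosen vertices, where two overlaps would coincide. In
   all at most 5k^3 q vertices are excluded. *)
pose F1 (s : G) := nbrs s :|: unlinked s.
pose F2 (x : G * G) := if x.1 == x.2 then set0 else \bigcup_(w in nbrs x.1 :&: nbrs x.2) nbrs w.
have c1 s : s \in S -> #|F1 s| <= q + 3 * k ^ 2 * q.
  move=> /(subsetP SA); rewrite in_setD inE => /andP[sD sq].
  by apply: leq_trans (leq_card_setU _ _) _; apply: leq_add => //; apply: card_unlinked.
have c2 x : x \in setX S S -> #|F2 x| <= 2 * q.
  move=> _; rewrite /F2; case: eqP => [_|/eqP ne]; first by rewrite cards0.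
  apply: leq_trans (leq_card_bigcup (b := 2 * q) _) _; first by move=> w _; apply: max_degree.
  by rewrite -[X in _ <= X]mul1n leq_mul2r frG ?orbT.
have [|v vA vB] := setD_nonempty (A := A)
    (B := S :|: (\bigcup_(s in S) F1 s :|: \bigcup_(x in setX S S) F2 x)).
  apply: leq_ltn_trans (card_deg_le_q hD).
  apply: leq_trans (leq_card_setU _ _) _.
  apply: leq_trans (leq_add (leqnn _) (leq_card_setU _ _)) _.
  have := leq_card_bigcup c1; have := leq_card_bigcup c2; rewrite cardsX.
  set a := #|\bigcup_(_ in _) _|; set b := #|\bigcup_(_ in _) _| => h2 h1.
  have g1 : #|S| * (q + 3 * k ^ 2 * q) <= k * (q + 3 * k ^ 2 * q) by rewrite leq_mul2r (ltnW Sk) orbT.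
  have g2 : #|S| * #|S| * (2 * q) <= k * k * (2 * q) by rewrite leq_mul2r leq_mul ?orbT // ltnW.
  apply: leq_trans (_ : k + (k * (q + 3 * k ^ 2 * q) + k * k * (2 * q)) <= _); first by lia.
  have g3 : k <= q := k_le_q.
  have g4 : 9 * k <= k ^ 3 by rewrite expnSr leq_mul2r -[9]/(3 ^ 2) leq_exp2r ?k_ge3 ?orbT.
  have g5 : 3 * (k * k) <= k ^ 3 by rewrite mulnn expnS leq_mul2r k_ge3 orbT.
  have -> : k * (q + 3 * k ^ 2 * q) + k * k * (2 * q) = q * (k + 3 * k ^ 3 + 2 * (k * k)).
    by rewrite !expnS expn0; lia.
  have : q * (9 * k) <= q * k ^ 3 by rewrite leq_mul2l g4 orbT.
  have : q * (3 * (k * k)) <= q * k ^ 3 by rewrite leq_mul2l g5 orbT.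
  have : q * 3 <= q * k by rewrite leq_mul2l k_ge3 orbT.
  by move: k_ge3 g3; clear; move: (k * k) (k ^ 3) => K2 K3; lia.
move: vB; rewrite !in_setU !negb_or => /and3P[vS vF1 vF2]; exists v => //.
have nadj s : s \in S -> ~~ adj s v.
  by move=> sS; apply: contra vF1 => h; apply/bigcupP; exists s; rewrite // !inE h.
have link s : s \in S -> exists2 w, adj s w & adj v w.
  move=> sS; have : v \notin unlinked s.
    by apply: contra vF1 => h; apply/bigcupP; exists s; rewrite // in_setU h orbT.
  by rewrite inE => /pred0Pn[w /andP[]] /=; rewrite !inE; exists w.
split.
- by rewrite subUset sub1set vA.
- move=> x y /setU1P[->|xS] /setU1P[->|yS]; first by rewrite adj_irr.
  + by rewrite adj_sym nadj.
  + exact: nadj.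
  + exact: indS.
have nU : nbrsU (v |: S) = nbrs v :|: nbrsU S by rewrite /nbrsU big_setU1.
have vq : #|nbrs v| <= q by move: vA; rewrite in_setD inE => /andP[].
(* A common neighbour of [s] and [v]; the default [v] never occurs for [s] in [S]. *)
pose c s := odflt v [pick w | adj s w && adj v w].
have cP s : s \in S -> adj s (c s) && adj v (c s).
  move=> sS; rewrite /c; case: pickP => //= h; have [w sw vw] := link s sS.
  by have := h w; rewrite sw vw.
(* distinct [s] use distinct common neighbours with [v], by the choice of [v] *)
have cinj : {in S &, injective c}.
  move=> s s' sS s'S ecs; apply/eqP/negPn/negP => ne.
  case/negP: vF2; apply/bigcupP; exists (s, s'); first by rewrite inE sS.
  rewrite /F2 /= (negPf ne); apply/bigcupP; exists (c s).
    by rewrite !inE {2}ecs; case/andP: (cP s sS) => -> _; case/andP: (cP s' s'S) => ->.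
  by rewrite inE adj_sym; case/andP: (cP s sS).
have : #|S| <= #|nbrs v :&: nbrsU S|.
  rewrite -(card_in_imset cinj); apply: subset_leq_card; apply/subsetP => _ /imsetP[s sS ->].
  rewrite in_setI inE; case/andP: (cP s sS) => h ->; apply/bigcupP; exists s => //.
  by rewrite inE.
have := cardsUI (nbrs v) (nbrsU S).
by rewrite nU cardsU1 vS add1n binS bin1 mulSn; lia.
Qed.

End UpperBound.

Lemma leq_bin2 (k : nat) : 3 <= k -> k <= 'C(k, 2).
Proof.
have := mul_bin_diag k 1; rewrite bin1; case: k => // k /= e k3.
have : k.+1 * 2 <= k.+1 * k by rewrite leq_mul2l.
by lia.
Qed.

(** All vertices outside [S] and its neighbourhood serve as pages: at least q^2 + t - k - (kq -
    'C(k, 2)), which is exactly [book_size k q t]. *)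
Lemma ramsey_upper (k q t e : nat) : 3 <= k -> 20 * k ^ 4 <= e -> t + e <= q ->
  ramsey_prop C4 (book k (book_size k q t)) (q ^ 2 + t).
Proof.
move=> k3 e_big te G szG; have [fr|] := C4free_dec G; last by left.
right; have qk : 10 * k ^ 2 <= q.
  have : k ^ 2 <= k ^ 4 by rewrite leq_pexp2l //; lia.
  by move: (k ^ 2) (k ^ 4) e_big te; clear; lia.
have [||S [cS indS US]] := @small_neighborhood_union G k q e fr k3 qk _ _ e_big.
- by lia.
- by lia.
apply: (@contains_book _ _ _ S (~: (S :|: nbrsU S))) => //.
- have := cardsC (S :|: nbrsU S); have [+ _] := leq_card_setU S (nbrsU S).
  rewrite cS szG /book_size /a_.
  have : k * q <= q ^ 2 by rewrite -mulnn leq_mul2r (leq_of_sqr_leq _ qk) ?orbT.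
  have := leq_bin2 k3.
  move: (q ^ 2) (k * q) 'C(k, 2) US => Q2 kq C; lia.
- by rewrite -subsets_disjoint subsetUl.
- move=> x y xS; rewrite !inE negb_or => /andP[_]; apply: contra => xy.
  by apply/bigcupP; exists x; rewrite // inE.
Qed.

(** * Graphs from polarities *)

Section GraphOn.

Variables (V : finType) (r : rel V) (r_sym : symmetric r) (S : {set V}).

(** The set [S] is deleted, and so are the loops of [r], which for a polarity sit at the absolute
    points. *)
Definition graph_on_adj : rel {x | x \notin S} :=
  fun x y => (val x != val y) && r (val x) (val y).

Lemma graph_on_adj_sym : symmetric graph_on_adj.
Proof. by move=> x y; rewrite /graph_on_adj eq_sym r_sym. Qed.

Lemma graph_on_adj_irr : irreflexive graph_on_adj.
Proof. by move=> x; rewrite /graph_on_adj eqxx. Qed.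

Definition graph_on : sgraph := SGraph graph_on_adj_sym graph_on_adj_irr.

Lemma card_graph_on : #|graph_on| = #|V| - #|S|.
Proof.
rewrite -(cardsC S) addKn card_sig; apply: eq_card => x; by rewrite !inE.
Qed.

Lemma card_nbrs_graph_on (x : graph_on) :
  #|nbrs x| = #|[set y in ~: S | (val x != y) && r (val x) y]|.
Proof.
rewrite -(card_imset _ val_inj); apply: eq_card => y; rewrite !inE.
apply/imsetP/andP => [[z]|[yS h]].
  by rewrite inE => h ->; split; [exact: (svalP z) | exact: h].
by exists (Sub y yS); rewrite ?SubK // inE.
Qed.

Lemma C4free_graph_on :
  (forall x y u v, x \notin S -> y \notin S -> u \notin S -> v \notin S ->
    x != y -> x != u -> y != u -> x != v -> y != v ->
    r x u -> r y u -> r x v -> r y v -> u = v) ->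
  C4free graph_on.
Proof.
move=> h x y xy; apply/card_le1P => u; rewrite !inE.
move=> /andP[/andP[a1 a2] /andP[a3 a4]] v; rewrite !inE.
apply/andP/eqP => [[/andP[b1 b2] /andP[b3 b4]]|->]; last by rewrite /= /graph_on_adj a1 a2 a3 a4.
have outS (z : graph_on) : val z \notin S := svalP z.
by apply: val_inj; apply: (h (val x) (val y)) => //; apply: outS.
Qed.

End GraphOn.

(** If some M < N had the Ramsey property, an induced subgraph of [G] on M vertices would pass one
    of the two forbidden configurations on to [G]. *)
Lemma is_ramsey_numberI (H1 H2 G : sgraph) (N : nat) :
  ramsey_prop H1 H2 N -> #|G| = N.-1 ->
  ~ contains_subgraph G H1 -> ~ contains_subgraph (compl_graph G) H2 ->
  is_ramsey_number H1 H2 N.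
Proof.
move=> up szG n1 n2; split=> // M ramM; rewrite leqNgt; apply/negP => MN.
have MG : M <= #|G| by rewrite szG; lia.
pose S : {set G} := ~: [set x in take M (enum G)].
have cS : #|S| = #|G| - M.
  rewrite cardsCs setCK cardsE (card_uniqP _) ?take_uniq ?enum_uniq //.
  by rewrite size_take_min -cardE (minn_idPl MG).
have [|[f [finj fadj]]|[f [finj fadj]]] := ramM (graph_on (@adj_sym G) S).
- by rewrite card_graph_on cS subKn.
- apply: n1; exists (fun x => val (f x)); split; first by move=> x y /val_inj/finj.
  by move=> x y /fadj /andP[].
- apply: n2; exists (fun x => val (f x)); split; first by move=> x y /val_inj/finj.
  move=> x y /fadj /andP[ne nadj]; rewrite -val_eqE in ne.
  apply/andP; split=> //; apply: contra nadj => h.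
  by rewrite /= /graph_on_adj ne.
Qed.

Definition C4free_min_degree (q n : nat) : Prop :=
  exists G : sgraph, [/\ #|G| = n, C4free G & forall x : G, q <= #|nbrs x|].

Lemma is_ramsey_number_book (k q t e : nat) :
  3 <= k -> 20 * k ^ 4 <= e -> t + e <= q -> 0 < q ->
  C4free_min_degree q (q ^ 2 + t).-1 ->
  is_ramsey_number C4 (book k (book_size k q t)) (q ^ 2 + t).
Proof.
move=> k3 e_big te q0 [G [szG fr dmin]].
apply: (is_ramsey_numberI (ramsey_upper k3 e_big te) szG).
  exact: C4free_not_contains.
(* The graph is exactly one vertex short of what the book and its neighbourhood would require. *)
apply: (not_contains_book fr dmin); rewrite szG /book_size /a_.
have q2 : 0 < q ^ 2 by rewrite expn_gt0 q0.
have := leq_bin2 k3.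
by move: (q ^ 2) (k * q) 'C(k, 2) q2 => Q2 kq C; lia.
Qed.

(** * Deletions and switches in an abstract polarity *)

Section Polarity.

Variables (V : finType) (perp : rel V) (q : nat).
(** [perp x y] reads: y lies on the polar line of x. Distinct polar lines meet in at most one point,
    and each has at least q + 1 points. *)
Hypothesis perp_sym : symmetric perp.
Hypothesis perp_uniq : forall x y u v, x != y ->
  perp x u -> perp y u -> perp x v -> perp y v -> u = v.
Hypothesis perp_deg : forall x, q < #|[set y | perp x y]|.

(** Of its q + 1 perpendicular points a survivor [w] loses those in [S] and, if absolute, itself;
    the hypothesis caps this loss at one. *)
Lemma deletion_graph (S : {set V}) :
  (forall w u v, w \notin S -> u \in w |: S -> v \in w |: S ->
     perp w u -> perp w v -> u = v) ->
  C4free_min_degree q (#|V| - #|S|).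
Proof.
move=> h; exists (graph_on perp_sym S); split; first exact: card_graph_on.
  apply: C4free_graph_on => x y u v _ _ _ _ xy _ _ _ _; exact: perp_uniq.
move=> x; rewrite card_nbrs_graph_on.
have := perp_deg (val x); rewrite -(cardsID (val x |: S)).
have : #|[set y | perp (val x) y] :&: (val x |: S)| <= 1.
  apply/card_le1_eqP => u v; rewrite in_setI inE => /andP[pu uS].
  rewrite in_setI inE => /andP[pv vS].
  by apply: (h (val x)) => //; exact: (valP x).
have : #|[set y | perp (val x) y] :\: (val x |: S)| <=
       #|[set y in ~: S | (val x != y) && perp (val x) y]|.
  apply: subset_leq_card; apply/subsetP => y.
  by rewrite !inE negb_or eq_sym => /andP[/andP[-> ->] ->].
by lia.
Qed.

(** For a conic these are the points on no tangent: perpendicular to an absolute point means lying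
    on its tangent. *)
Definition internal (x : V) : Prop := forall w, perp w w -> ~~ perp x w.

Variable p : V.

(** A deletion set of this shape costs every survivor off the polar line of [p] at most one
    perpendicular point; only survivors on that line, which lose [p], need further care. *)
Definition pencil (S : {set V}) : Prop := [/\ p \in S,
  forall u, u \in S -> u != p -> perp p u,
  forall w, w \notin S -> perp p w -> ~~ perp w w &
  forall w u, w \notin S -> perp w w -> u \in S -> u != p -> ~~ perp w u].

(** A survivor on the polar line of [p] loses only [p], an absolute one only its loop, and any other
    only the meet of its polar line with that of [p]. *)
Lemma pencil_deletion_graph (S : {set V}) : pencil S ->
  (forall w u, w \notin S -> perp p w -> u \in S -> u != p -> ~~ perp w u) ->
  C4free_min_degree q (#|V| - #|S|).
Proof.
move=> [pS Sp absP absS] closed; apply: deletion_graph => w u v wS uS vS wu wv.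
have neq z : z \in S -> w != z by apply: contraTneq => <-.
have [pw|pw] := boolP (perp p w).
  have eqp z : z \in w |: S -> perp w z -> z = p.
    case/setU1P=> [->|zS] wz; first by move: (absP _ wS pw); rewrite wz.
    by apply/eqP/negPn/negP => /(closed _ _ wS pw zS); rewrite wz.
  by rewrite (eqp u uS wu) (eqp v vS wv).
have np z : perp w z -> z != p by apply: contraTneq => ->; rewrite perp_sym.
have [ww|ww] := boolP (perp w w).
  have eqw z : z \in w |: S -> perp w z -> z = w.
    case/setU1P=> [->|zS] wz //.
    by move: (absS _ _ wS ww zS (np _ wz)); rewrite wz.
  by rewrite (eqw u uS wu) (eqw v vS wv).
have inS z : z \in w |: S -> perp w z -> perp p z.
  case/setU1P=> [->|zS] wz; first by rewrite wz in ww.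
  exact: Sp zS (np _ wz).
by apply: (perp_uniq (neq _ pS)) => //; apply: inS.
Qed.

(* Two deficient points [a], [b] of the polar line of [p] are repaired by the
   new edge [ab]; the 4-cycles it would create are destroyed by deleting the
   edges between the polar lines of [a] and [b]. *)
Lemma pencil_switch_graph (S : {set V}) (a b : V) : pencil S ->
  a != b -> a \notin S -> b \notin S -> perp p a -> perp p b -> ~~ perp a b ->
  internal a -> internal b ->
  (forall w u, w \notin S -> w != a -> w != b -> perp p w ->
     u \in S -> u != p -> ~~ perp w u) ->
  C4free_min_degree q (#|V| - #|S|).
Proof.
move=> [pS Sp absP absS] ab aS bS pa pb nab inta intb closed.
(* [E] is the new edge, [M] the pairs between the two polar lines, [r] the switched adjacency. *)
pose E u v := (u == a) && (v == b) || (u == b) && (v == a).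
pose M u v := (perp u a && perp v b) || (perp u b && perp v a).
pose r u v := perp u v && ~~ M u v || E u v.
have E_sym : symmetric E.
  by move=> u v; rewrite /E orbC [(v == b) && _]andbC [(v == a) && _]andbC.
have M_sym : symmetric M.
  by move=> u v; rewrite /M orbC [perp v b && _]andbC [perp v a && _]andbC.
have r_sym : symmetric r by move=> u v; rewrite /r perp_sym M_sym E_sym.
have EM c d u v : E c d -> perp u c -> perp v d -> M u v.
  by rewrite /M; case/orP=> /andP[/eqP-> /eqP->] -> ->; rewrite ?orbT.
have MP u v : M u v -> exists c d, [/\ E c d, perp u c & perp v d].
  by case/orP=> /andP[h1 h2]; [exists a, b | exists b, a]; rewrite /E !eqxx ?orbT.
have Einj c d d' : E c d -> E c d' -> d = d'.
  move=> /orP[]/andP[/eqP-> /eqP->] /orP[]/andP[/eqP h /eqP->] //;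
    by move: ab; rewrite h eqxx.
have Efacts c d : E c d -> [/\ c != d, ~~ perp c d, perp p c, internal c & c \notin S].
  by case/orP=> /andP[/eqP-> /eqP->]; split=> //; rewrite 1?eq_sym // perp_sym.
have rE u v : r u v -> ~~ E u v -> perp u v && ~~ M u v.
  by rewrite /r; case: (E u v) => //; rewrite orbF.
(* A 4-cycle through the new edge cd needs a path c-u-v-d; but then u and v lie on the polar lines
   of c and d, so uv was deleted. *)
have path c d u v : E c d -> c != u -> u != d -> u != v -> v != c -> v != d ->
    r c u -> r u v -> r v d -> False.
  move=> Ecd cu ud uv vc vd rcu ruv rvd.
  have Edc : E d c by rewrite E_sym.
  have /andP[pcu _] : perp c u && ~~ M c u.
    by apply: rE => //; apply: contra ud => /(Einj _ _ _ Ecd) ->.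
  have /andP[pdv _] : perp d v && ~~ M d v.
    by apply: rE; [rewrite r_sym | apply: contra vc => /(Einj _ _ _ Edc) ->].
  have /andP[puv /negP] : perp u v && ~~ M u v.
    apply: rE => //; apply: contra cu => Euv.
    move: Euv Ecd ud; rewrite /E => /orP[]/andP[/eqP-> _] /orP[]/andP[/eqP-> /eqP->];
      by rewrite ?eqxx.
  by apply; apply: EM Ecd _ _; rewrite perp_sym.
exists (graph_on r_sym S); split; first exact: card_graph_on.
  apply: C4free_graph_on => x y u v xS yS uS vS xy xu yu xv yv rxu ryu rxv ryv.
  apply/eqP/negPn/negP => uv.
  have rux : r u x by rewrite r_sym.
  have ruy : r u y by rewrite r_sym.
  have rvx : r v x by rewrite r_sym.
  have rvy : r v y by rewrite r_sym.
  have [E1|/(rE _ _ rxu)/andP[p1 _]] := boolP (E x u).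
    by apply: (path _ _ v y E1); rewrite // 1?eq_sym.
  have [E2|/(rE _ _ ryu)/andP[p2 _]] := boolP (E y u).
    by apply: (path _ _ v x E2); rewrite // 1?eq_sym.
  have [E3|/(rE _ _ rxv)/andP[p3 _]] := boolP (E x v).
    by apply: (path _ _ u y E3); rewrite // 1?eq_sym.
  have [E4|/(rE _ _ ryv)/andP[p4 _]] := boolP (E y v).
    by apply: (path _ _ u x E4); rewrite // 1?eq_sym.
  by move: uv; rewrite (perp_uniq xy p1 p2 p3 p4) eqxx.
move=> x; rewrite card_nbrs_graph_on; move: (val x) (valP x) => /= {x} w wS.
(* The perpendicular points [w] can lose: deleted points, itself, and the far ends of switched
   edges. *)
pose B := [set u | [|| u \in S, u == w | M w u]].
have := perp_deg w; rewrite -(cardsID B).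
have neq z : z \in S -> w != z by apply: contraTneq => <-.
have sub : [set y | perp w y] :\: B \subset [set y in ~: S | (w != y) && r w y].
  apply/subsetP => y; rewrite !inE !negb_or /r eq_sym.
  by case/andP=> /and3P[-> -> h] ->; rewrite /M negb_or h.
(* An end of the new edge loses [p] and at most one more point, the meet of its polar line with that
   of [p], but gains the other end. *)
have [/existsP[d Ewd]|/existsPn noE] := boolP [exists d, E w d].
  have [wd nwd pw intw _] := Efacts _ _ Ewd.
  have Edw : E d w by rewrite E_sym.
  have [_ _ pd intd dS] := Efacts _ _ Edw.
  have B1 : #|([set y | perp w y] :&: B) :\ p| <= 1.
    have in1 u : u \in ([set y | perp w y] :&: B) :\ p -> perp w u /\ perp p u.
      rewrite !inE => /and3P[up wu /or3P[uS|/eqP uw|/MP[c [d' [Ecd wc ud]]]]].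
      - by split=> //; apply: Sp.
      - by move: wu; rewrite uw => ww; move: (intw _ ww); rewrite ww.
      - have [_ _ _ intc _] := Efacts _ _ Ecd.
        have : (c == w) || (c == d).
          move: Ecd Ewd; rewrite /E => /orP[]/andP[/eqP-> _] /orP[]/andP[/eqP-> /eqP->];
            by rewrite eqxx ?orbT.
        case/orP=> /eqP ec; last by move: nwd; rewrite -ec wc.
        by move: wc (intw w); rewrite ec => ww /(_ ww); rewrite ww.
    apply/card_le1_eqP => u v /in1[wu pu] /in1[wv pv].
    exact: (perp_uniq (neq _ pS)).
  have B2 : #|[set y | perp w y] :&: B| <= 2.
    by rewrite (cardsD1 p) -[2]/(1 + 1) leq_add ?leq_b1.
  have dN : d \in [set y in ~: S | (w != y) && r w y].
    by rewrite !inE dS wd /r Ewd orbT.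
  have dB : d \notin [set y | perp w y] :\: B by rewrite !inE (negPf nwd) andbF.
  have := subset_leq_card (_ : d |: ([set y | perp w y] :\: B) \subset
     [set y in ~: S | (w != y) && r w y]).
  rewrite cardsU1 dB subUset sub1set dN sub => /(_ isT); move: B2.
  by move: #|_ :&: B| #|_ :\: B| #|[set y in ~: S | (w != y) && r w y]|;
    clear; lia.
have wa : w != a by apply: contraNneq (noE b) => ->; rewrite /E !eqxx.
have wb : w != b by apply: contraNneq (noE a) => ->; rewrite /E !eqxx orbT.
have Ew c d : E c d -> w != d by case/orP=> /andP[_ /eqP->].
suff : #|[set y | perp w y] :&: B| <= 1.
  by have := subset_leq_card sub; move: #|_ :&: B| #|_ :\: B| #|[set y in ~: S | (w != y) && r w y]|;
    clear; lia.
apply/card_le1_eqP => u v; rewrite !inE => /andP[wu uB] /andP[wv vB].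
have [pw|pw] := boolP (perp p w).
  have eqp z : perp w z -> [|| z \in S, z == w | M w z] -> z = p.
    move=> wz /or3P[zS|/eqP zw|/MP[c [d [Ecd wc zd]]]].
    - by apply/eqP/negPn/negP => /(closed _ _ wS wa wb pw zS); rewrite wz.
    - by move: (absP _ wS pw); rewrite -{2}zw wz.
    - have Edc : E d c by rewrite E_sym.
      have [_ _ pd _ _] := Efacts _ _ Edc.
      apply: (perp_uniq (Ew _ _ Ecd)) => //; first by rewrite perp_sym.
        by rewrite perp_sym.
      by rewrite perp_sym.
  by rewrite (eqp u wu uB) (eqp v wv vB).
have np z : perp w z -> z != p by apply: contraTneq => ->; rewrite perp_sym.
have [ww|ww] := boolP (perp w w).
  have eqw z : perp w z -> [|| z \in S, z == w | M w z] -> z = w.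
    move=> wz /or3P[zS|/eqP//|/MP[c [d [Ecd wc zd]]]].
      by move: (absS _ _ wS ww zS (np _ wz)); rewrite wz.
    have [_ _ _ intc _] := Efacts _ _ Ecd.
    by move: (intc _ ww); rewrite perp_sym wc.
  by rewrite (eqw u wu uB) (eqw v wv vB).
have cases z : perp w z -> [|| z \in S, z == w | M w z] ->
    (z \in S /\ perp p z) \/ exists c d, [/\ E c d, perp w c & perp z d].
  move=> wz /or3P[zS|/eqP zw|/MP]; last by right.
    by left; split=> //; apply: Sp zS (np _ wz).
  by move: ww; rewrite -{2}zw wz.
(* The polar lines of [w] and [p] meet once, so a deleted [z] there would equal the surviving [c];
   hence a vertex does not suffer both kinds of loss. *)
have clash z c d : z \in S -> perp p z -> perp w z -> E c d -> perp w c -> False.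
  move=> zS pz wz Ecd wc; have [_ _ pc _ cS] := Efacts _ _ Ecd.
  by move: cS; rewrite -(perp_uniq (neq _ pS) wz pz wc pc) zS.
case: (cases u wu uB) (cases v wv vB) => [[uS pu]|[c [d [Ecd wc ud]]]] [[vS pv]|[c' [d' [Ecd' wc' vd]]]].
- exact: (perp_uniq (neq _ pS)).
- by case: (clash u c' d').
- by case: (clash v c d).
have [_ _ pc _ _] := Efacts _ _ Ecd; have [_ _ pc' _ _] := Efacts _ _ Ecd'.
have ec : c = c' by apply: (perp_uniq (neq _ pS)).
have ed : d = d' by apply: Einj Ecd _; rewrite ec.
by apply: (perp_uniq (Ew _ _ Ecd)); rewrite // perp_sym // ed.
Qed.

(** [I] consists of internal points on the polar line of [p], and [inv] is conjugation on that line: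
    [inv z] is its point perpendicular to [z]. *)
Variables (I : {set V}) (inv : V -> V).
Hypothesis I_perp : forall z, z \in I -> perp p z.
Hypothesis I_int : forall z, z \in I -> internal z.
Hypothesis inv_I : forall z, z \in I -> inv z \in I.
Hypothesis perp_inv : forall z, z \in I -> perp z (inv z).

Definition pencil_base : {set V} := p |: [set c | perp p c && perp c c].

Lemma internal_set_neq (z : V) : z \in I -> z != p.
Proof.
move=> zI; apply/eqP => zp; have := I_int zI; have := I_perp zI; rewrite zp => pp.
by move=> /(_ _ pp); rewrite pp.
Qed.

Lemma internal_set_nonabs (z : V) : z \in I -> ~~ perp z z.
Proof. by move=> zI; apply/negP => zz; have := I_int zI zz; rewrite zz. Qed.

Lemma polar_inv (z w : V) : z \in I -> perp p w -> perp w z -> w = inv z.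
Proof.
move=> zI pw wz; apply: (perp_uniq (internal_set_neq zI)) => //; first by rewrite perp_sym.
  exact: perp_inv.
exact/I_perp/inv_I.
Qed.

Lemma polar_invK (z : V) : z \in I -> inv (inv z) = z.
Proof.
move=> zI; apply/esym/polar_inv; [exact: inv_I | exact: I_perp | exact: perp_inv].
Qed.

Lemma polar_inv_neq (z : V) : z \in I -> inv z != z.
Proof. by move=> zI; apply: contraTneq (perp_inv zI) => ->; exact: internal_set_nonabs. Qed.

Lemma card_pencil_baseU (X : {set V}) : X \subset I ->
  #|pencil_base :|: X| = #|pencil_base| + #|X|.
Proof.
move=> /subsetP XI; rewrite -cardsUI [X in _ = _ + X](_ : _ = 0) ?addn0 //.
apply/eqP; rewrite cards_eq0; apply/eqP/setP => z; rewrite !inE.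
apply/negP => /andP[/orP[zp|/andP[_ zz]] /XI zI].
  by move: (internal_set_neq zI); rewrite zp.
by move: (internal_set_nonabs zI); rewrite zz.
Qed.

(** Two distinct absolute points are never perpendicular, since both would lie on both polar lines;
    internal points are perpendicular to no absolute point. *)
Lemma pencil_baseU (X : {set V}) : X \subset I -> pencil (pencil_base :|: X).
Proof.
move=> /subsetP XI; split.
- by rewrite !inE eqxx.
- move=> u; rewrite !inE -orbA => /or3P[->//|/andP[]//|/XI /I_perp //].
- move=> w; rewrite !inE !negb_or negb_and => /andP[/andP[_ h] _] pw.
  by move: h; rewrite pw.
- move=> w u wS ww; rewrite !inE -orbA => /or3P[->//|/andP[pu uu]|/XI uI] _.
    apply: contra wS => wu; have [->|ne] := eqVneq w u; first by rewrite !inE pu uu orbT.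
    by rewrite (perp_uniq ne ww _ wu uu) ?inE ?pu ?uu ?orbT // perp_sym.
  by rewrite perp_sym; apply: I_int.
Qed.

(** The polar line of an absolute [u] on the polar line of [p] meets the latter only in [u]. So
    besides [p] a survivor on that line can lose only its conjugate. *)
Lemma pencil_baseU_perp (X : {set V}) (w u : V) : X \subset I ->
  w \notin pencil_base :|: X -> perp p w -> u \in pencil_base :|: X -> u != p ->
  perp w u -> u \in X /\ w = inv u.
Proof.
move=> /subsetP XI wS pw; rewrite !inE -orbA => /or3P[->//|/andP[pu uu]|uX] up wu.
  case/negP: wS; rewrite (perp_uniq up _ pw uu pu) ?inE ?pu ?uu ?orbT //.
  by rewrite perp_sym.
by split=> //; apply: polar_inv => //; apply: XI.
Qed.

(** [inv] is an involution of [I] without fixed points, so conjugate pairs can be added one at a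
    time. *)
Lemma inv_closed_subset (j : nat) : 2 * j <= #|I| -> exists X : {set V},
  [/\ X \subset I, #|X| = 2 * j & {in X, forall z, inv z \in X}].
Proof.
elim: j => [_|j IH hj].
  by exists set0; split; rewrite ?sub0set ?cards0 // => z; rewrite inE.
have [|X [XI cX invX]] := IH; first by lia.
have [|z zI zX] := setD_nonempty (A := I) (B := X); first by rewrite cX; lia.
have izX : inv z \notin X by apply: contra zX => /invX; rewrite polar_invK.
exists (z |: (inv z |: X)); split.
- by rewrite !subUset !sub1set zI inv_I.
- by rewrite !cardsU1 !inE izX negb_or eq_sym polar_inv_neq // zX cX; lia.
- move=> y; rewrite !inE => /or3P[/eqP->|/eqP->|/invX->]; last by rewrite !orbT.
    by rewrite eqxx orbT.
  by rewrite polar_invK // eqxx.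
Qed.

(** When whole conjugate pairs are deleted, no survivor on the polar line of [p] loses its
    conjugate. *)
Lemma pencil_graph_even (j : nat) : 2 * j <= #|I| ->
  C4free_min_degree q (#|V| - (#|pencil_base| + 2 * j)).
Proof.
case/inv_closed_subset=> X [XI <- invX]; rewrite -card_pencil_baseU //.
apply: pencil_deletion_graph; first exact: pencil_baseU.
move=> w u wS pw uS up; apply/negP => wu.
have [uX e] := pencil_baseU_perp XI wS pw uS up wu.
by case/negP: wS; rewrite e in_setU invX ?orbT.
Qed.

(** The single extra point [x] leaves [inv x] deficient, which the switch with [y] repairs. The
    summand 4 makes room for [x], [y] and their conjugates. *)
Lemma pencil_graph_odd (j : nat) : 2 * j + 4 <= #|I| ->
  C4free_min_degree q (#|V| - (#|pencil_base| + 2 * j + 1)).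
Proof.
move=> hj; have [|X [XI cX invX]] := @inv_closed_subset j; first by lia.
have [|x xI xX] := setD_nonempty (A := I) (B := X); first by rewrite cX; lia.
have [|y yI] := setD_nonempty (A := I) (B := x |: (inv x |: X)).
  by rewrite !cardsU1 cX; case: (_ \notin _); case: (_ \notin _); lia.
rewrite !inE !negb_or => /and3P[yx yix yX].
have ixX : inv x \notin X by apply: contra xX => /invX; rewrite polar_invK.
have ixI := inv_I xI.
have X'I : x |: X \subset I by rewrite subUset sub1set xI.
have -> : #|pencil_base| + 2 * j + 1 = #|pencil_base :|: (x |: X)|.
  by rewrite card_pencil_baseU // cardsU1 xX cX; lia.
have notS z : z \in I -> z \notin x |: X -> z \notin pencil_base :|: (x |: X).
  move=> zI zX; rewrite in_setU negb_or zX andbT !inE negb_or internal_set_neq //=.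
  by rewrite negb_and internal_set_nonabs ?orbT.
apply: (@pencil_switch_graph _ (inv x) y).
- exact: pencil_baseU.
- by rewrite eq_sym.
- by apply: notS; rewrite // !inE negb_or polar_inv_neq.
- by apply: notS; rewrite // !inE negb_or yx.
- exact: I_perp.
- exact: I_perp.
- apply/negP => ixy; case/eqP: yx; rewrite -(polar_invK xI).
  by apply: polar_inv => //; [exact: I_perp | rewrite perp_sym].
- exact: I_int.
- exact: I_int.
move=> w u wS wix wy pw uS up; apply/negP => wu.
have [/setU1P[ux|uX] e] := pencil_baseU_perp X'I wS pw uS up wu.
  by move: wix; rewrite e ux eqxx.
by case/negP: wS; rewrite e !in_setU invX ?orbT.
Qed.

End Polarity.

(** * Polarities of PG(2, q) *)

Section ProjectivePlane.

Variable F : finFieldType.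
Local Open Scope ring_scope.

(* Normalised homogeneous coordinates: [inl (a, b)] is (a:b:1), [inr (Some a)]
   is (a:1:0) and [inr None] is (1:0:0). *)
Definition point : finType := ((F * F) + option F)%type.

Definition cx (v : point) : F :=
  match v with inl ab => ab.1 | inr (Some a) => a | inr None => 1 end.
Definition cy (v : point) : F :=
  match v with inl ab => ab.2 | inr (Some _) => 1 | inr None => 0 end.
Definition cz (v : point) : F := if v is inl _ then 1 else 0.

Lemma card_point : #|point| = (#|F| ^ 2 + #|F| + 1)%N.
Proof. by rewrite card_sum card_prod card_option -mulnn addn1 addnS. Qed.

Lemma point_nz (v : point) : cx v = 0 -> cy v = 0 -> cz v = 0 -> False.
Proof.
case: v => [[a b]|[a|]] /= h1 h2 h3; have := oner_neq0 F.
- by rewrite h3 eqxx.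
- by rewrite h2 eqxx.
- by rewrite h1 eqxx.
Qed.

Lemma point_inj (u v : point) : cx u * cy v = cy u * cx v ->
  cx u * cz v = cz u * cx v -> cy u * cz v = cz u * cy v -> u = v.
Proof.
have n10 := oner_neq0 F.
case: u => [[a b]|[a|]]; case: v => [[c d]|[c|]] //=; rewrite ?(mulr1, mul1r, mulr0, mul0r).
- by move=> _ -> ->.
- by move=> _ _ /eqP; rewrite eq_sym (negPf n10).
- by move=> _ /eqP; rewrite eq_sym (negPf n10).
- by move=> _ _ /eqP; rewrite (negPf n10).
- by move=> -> .
- by move=> /eqP; rewrite eq_sym (negPf n10).
- by move=> _ /eqP; rewrite (negPf n10).
- by move=> /eqP; rewrite (negPf n10).
Qed.

(** If u and v differed, their cross product would be nonzero and proportional to both x and y,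
    making x and y proportional. *)
Lemma cross_uniq (x1 x2 x3 y1 y2 y3 : F) (u v : point) :
  ~ [/\ x1 * y2 = x2 * y1, x1 * y3 = x3 * y1 & x2 * y3 = x3 * y2] ->
  x1 * cx u + x2 * cy u + x3 * cz u = 0 -> y1 * cx u + y2 * cy u + y3 * cz u = 0 ->
  x1 * cx v + x2 * cy v + x3 * cz v = 0 -> y1 * cx v + y2 * cy v + y3 * cz v = 0 ->
  u = v.
Proof.
set u1 := cx u; set u2 := cy u; set u3 := cz u.
set v1 := cx v; set v2 := cy v; set v3 := cz v.
move=> npr xu yu xv yv.
pose D1 := u2 * v3 - u3 * v2; pose D2 := u3 * v1 - u1 * v3; pose D3 := u1 * v2 - u2 * v1.
(* a vector orthogonal to [u] and [v] is proportional to [D], their cross product *)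
have prop z1 z2 z3 : z1 * u1 + z2 * u2 + z3 * u3 = 0 -> z1 * v1 + z2 * v2 + z3 * v3 = 0 ->
    [/\ D1 * z2 = D2 * z1, D1 * z3 = D3 * z1 & D2 * z3 = D3 * z2].
  move=> zu zv; split; apply/eqP; rewrite -subr_eq0 /D1 /D2 /D3; apply/eqP.
  - transitivity (v3 * (z1 * u1 + z2 * u2 + z3 * u3) - u3 * (z1 * v1 + z2 * v2 + z3 * v3)).
      by ring.
    by rewrite zu zv; ring.
  - transitivity (u2 * (z1 * v1 + z2 * v2 + z3 * v3) - v2 * (z1 * u1 + z2 * u2 + z3 * u3)).
      by ring.
    by rewrite zu zv; ring.
  - transitivity (v1 * (z1 * u1 + z2 * u2 + z3 * u3) - u1 * (z1 * v1 + z2 * v2 + z3 * v3)).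
      by ring.
    by rewrite zu zv; ring.
have [a12 a13 a23] := prop _ _ _ xu xv; have [b12 b13 b23] := prop _ _ _ yu yv.
have cancel (D A B C : F) : D * A = 0 -> D * B = 0 -> D * C = 0 ->
    (A = 0 -> B = 0 -> C = 0 -> False) -> D = 0.
  move=> hA hB hC n; apply/eqP/negPn/negP => D0.
  have f (Z : F) : D * Z = 0 -> Z = 0 by move/eqP; rewrite mulf_eq0 (negPf D0) => /eqP.
  by apply: n; apply: f.
(* Each coordinate of the cross product annihilates the three 2-by-2 minors of x and y, which do not
   all vanish. *)
have Dz i : (i = D1 \/ i = D2) \/ i = D3 -> i = 0.
  move=> hi; apply: (cancel _ (x1 * y2 - x2 * y1) (x1 * y3 - x3 * y1) (x2 * y3 - x3 * y2)).
  - case: hi => [[]|] ->.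
    + transitivity (x1 * (D1 * y2) - (D1 * x2) * y1); first by ring.
      by rewrite b12 a12; ring.
    + transitivity ((D2 * x1) * y2 - x2 * (D2 * y1)); first by ring.
      by rewrite -a12 -b12; ring.
    + transitivity ((D3 * x1) * y2 - (D3 * x2) * y1); first by ring.
      rewrite -a13 -a23; transitivity (x3 * (D1 * y2 - D2 * y1)); first by ring.
      by rewrite b12; ring.
  - case: hi => [[]|] ->.
    + transitivity (x1 * (D1 * y3) - (D1 * x3) * y1); first by ring.
      by rewrite b13 a13; ring.
    + transitivity ((D2 * x1) * y3 - (D2 * x3) * y1); first by ring.
      rewrite -a12 a23; transitivity (x2 * (D1 * y3 - D3 * y1)); first by ring.
      by rewrite b13; ring.
    + transitivity ((D3 * x1) * y3 - x3 * (D3 * y1)); first by ring.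
      by rewrite -a13 -b13; ring.
  - case: hi => [[]|] ->.
    + transitivity ((D1 * x2) * y3 - (D1 * x3) * y2); first by ring.
      rewrite a12 a13; transitivity (x1 * (D2 * y3 - D3 * y2)); first by ring.
      by rewrite b23; ring.
    + transitivity (x2 * (D2 * y3) - (D2 * x3) * y2); first by ring.
      by rewrite b23 a23; ring.
    + transitivity ((D3 * x2) * y3 - x3 * (D3 * y2)); first by ring.
      by rewrite -a23 -b23; ring.
  by move=> h1 h2 h3; apply: npr; split; apply/eqP; rewrite -subr_eq0 ?h1 ?h2 ?h3.
have e1 : D1 = 0 by apply: Dz; auto.
have e2 : D2 = 0 by apply: Dz; auto.
have e3 : D3 = 0 by apply: Dz; auto.
apply: point_inj; apply/eqP; rewrite -subr_eq0; apply/eqP => //.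
rewrite -/u1 -/u3 -/v1 -/v3; transitivity (- D2); first by rewrite /D2; ring.
by rewrite e2 oppr0.
Qed.

(** The line is parametrised by [option F], solving for the coordinate with the first nonzero
    coefficient. *)
Lemma line_card (a b c : F) : (a = 0 -> b = 0 -> c = 0 -> False) ->
  (#|F| < #|[set y : point | (a * cx y + b * cy y + c * cz y == 0)%R]|)%N.
Proof.
move=> nz.
have inj (f : option F -> point) : injective f ->
    (forall o, a * cx (f o) + b * cy (f o) + c * cz (f o) = 0) ->
    (#|F| < #|[set y : point | (a * cx y + b * cy y + c * cz y == 0)%R]|)%N.
  move=> finj h; rewrite -card_option -(card_imset _ finj).
  by apply: subset_leq_card; apply/subsetP => _ /imsetP[o _ ->]; rewrite inE h.
have [a0|a0] := eqVneq a 0; last first.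
  apply: (inj (fun o => if o is Some y then inl (- (b * y + c) / a, y)
                        else inr (Some (- b / a)))).
    by move=> [y|] [z|] //= [] _ ->.
  by move=> [y|] /=; field.
have [b0|b0] := eqVneq b 0; last first.
  apply: (inj (fun o => if o is Some x then inl (x, - c / b) else inr None)).
    by move=> [y|] [z|] //= [] ->.
  by move=> [y|] /=; rewrite a0; field.
have [c0|c0] := eqVneq c 0; first by case: nz.
apply: (inj (fun o => inr o)); first by move=> x y [].
by move=> [y|] /=; rewrite a0 b0; ring.
Qed.

(** Polarities of the quadratic forms x^2 + y^2 + z^2 and 2xy + z^2. The first is used for q = 3 mod
    4, the second for even q and for q = 1 mod 4. *)
Definition perp_dot : rel point :=
  fun u v => cx u * cx v + cy u * cy v + cz u * cz v == 0.
Definition perp_hyp : rel point :=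
  fun u v => cy u * cx v + cx u * cy v + cz u * cz v == 0.

Lemma perp_dot_sym : symmetric perp_dot.
Proof. by move=> u v; rewrite /perp_dot; congr (_ == 0); ring. Qed.

Lemma perp_hyp_sym : symmetric perp_hyp.
Proof. by move=> u v; rewrite /perp_hyp; congr (_ == 0); ring. Qed.

Lemma perp_dot_uniq (x y u v : point) : x != y ->
  perp_dot x u -> perp_dot y u -> perp_dot x v -> perp_dot y v -> u = v.
Proof.
move=> xy /eqP xu /eqP yu /eqP xv /eqP yv; apply: cross_uniq xu yu xv yv.
by case=> h1 h2 h3; case/eqP: xy; apply: point_inj.
Qed.

Lemma perp_hyp_uniq (x y u v : point) : x != y ->
  perp_hyp x u -> perp_hyp y u -> perp_hyp x v -> perp_hyp y v -> u = v.
Proof.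
move=> xy /eqP xu /eqP yu /eqP xv /eqP yv; apply: cross_uniq xu yu xv yv.
by case=> h1 h2 h3; case/eqP: xy; apply: point_inj.
Qed.

Lemma perp_dot_deg (x : point) : (#|F| < #|[set y | perp_dot x y]|)%N.
Proof. by apply: line_card => h1 h2 h3; apply: (@point_nz x). Qed.

Lemma perp_hyp_deg (x : point) : (#|F| < #|[set y | perp_hyp x y]|)%N.
Proof. by apply: line_card => h1 h2 h3; apply: (@point_nz x). Qed.

End ProjectivePlane.

(** * Even q *)

Lemma subset_of_card (T : finType) (A : {set T}) (n : nat) : n <= #|A| ->
  exists2 B : {set T}, B \subset A & #|B| = n.
Proof.
move=> nA; exists [set x in take n (enum A)].
  by apply/subsetP => x; rewrite inE => /mem_take; rewrite mem_enum.
rewrite cardsE (card_uniqP _) ?take_uniq ?enum_uniq //.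
by rewrite size_take_min -cardE (minn_idPl nA).
Qed.

Section EvenOrder.

Variable F : finFieldType.
Hypothesis char2 : (1 + 1 = 0 :> F)%R.
Local Open Scope ring_scope.

Let perp := @perp_hyp F.

(** In characteristic 2 the form 2xy + z^2 is z^2, so absolute points lie at infinity. *)
Lemma nonabs_affine (w : F * F) : ~~ perp (inl w) (inl w).
Proof.
rewrite /perp /perp_hyp /= mulr1 [w.2 * _]mulrC -[w.1 * w.2]mul1r -mulrDl char2.
by rewrite mul0r add0r oner_neq0.
Qed.

(** The case t = 0. All q + 1 absolute points form the line z = 0, the polar line of [P]; with [P]
    they make q + 2 deletions, and every other polar line meets z = 0 once. *)
Lemma even_graph_small : C4free_min_degree #|F| (#|F| ^ 2 - 1).
Proof.
pose P : point F := inl (0, 0).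
pose S : {set point F} := P |: [set inr o | o : option F].
have cS : #|S| = (#|F| + 2)%N.
  rewrite cardsU1 card_imset ?card_option; last by move=> ? ? [].
  by rewrite (_ : P \in _ = false) ?addn2 //; apply/imsetP => -[].
have -> : (#|F| ^ 2 - 1 = #|point F| - #|S|)%N.
  by rewrite card_point cS; move: (#|F| ^ 2)%N #|F|; clear; lia.
apply: (deletion_graph (@perp_hyp_sym F) (@perp_hyp_uniq F) (@perp_hyp_deg F)).
move=> [w|o] u v wS; last by case/negP: wS; rewrite !inE imset_f ?orbT.
have wP : inl w != P by apply: contraNneq wS => ->; rewrite setU11.
have polar z : z \in inl w |: S -> perp (inl w) z -> perp P z.
  case/setU1P=> [->|/setU1P[->|/imsetP[o _ ->]]].
  - by rewrite (negPf (nonabs_affine w)).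
  - by rewrite /perp /perp_hyp /= !mulr0 !add0r mulr1 oner_eq0.
  - by move=> _; rewrite /perp /perp_hyp /= !mul0r mulr0 !addr0.
move=> uS vS wu wv; apply: (perp_hyp_uniq wP) => //; exact: polar.
Qed.

(** The absolute point (1:0:0) and n points (x:0:1) are deleted, all on its polar line y = 0. The
    value x = 0 is avoided because (0:0:1) is perpendicular to all absolute points, which already
    lose their loops. *)
Lemma even_graph (n : nat) : (n < #|F|)%N ->
  C4free_min_degree #|F| (#|F| ^ 2 + #|F| - n).
Proof.
move=> nF; have [|X XF cX] := @subset_of_card F [set~ 0] n.
  by rewrite cardsC1 -ltnS prednK // ltnW // finNzRing_gt1.
have X0 x : x \in X -> x != 0 by move/(subsetP XF); rewrite !inE.
pose S : {set point F} := inr None |: [set inl (x, 0) | x in X].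
have cS : #|S| = n.+1.
  rewrite cardsU1 card_imset ?cX; last by move=> ? ? [].
  by rewrite (_ : inr None \in _ = false) //; apply/imsetP => -[].
have -> : (#|F| ^ 2 + #|F| - n = #|point F| - #|S|)%N.
  by rewrite card_point cS addn1 subSS.
apply: (deletion_graph (@perp_hyp_sym F) (@perp_hyp_uniq F) (@perp_hyp_deg F)).
move=> [[a b]|[m|]] u v wS; last by rewrite setU11 in wS.
  have cases z : z \in inl (a, b) |: S -> perp (inl (a, b)) z ->
      (z = inr None /\ b = 0) \/ exists2 x, z = inl (x, 0) & b * x = - 1.
    case/setU1P=> [->|/setU1P[->|/imsetP[x _ ->]]].
    - by rewrite (negPf (nonabs_affine _)).
    - by rewrite /perp /perp_hyp /= !mulr0 mulr1 !addr0 => /eqP ->; left.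
    - rewrite /perp /perp_hyp /= mulr0 mulr1 addr0 addr_eq0 => /eqP bx.
      by right; exists x.
  move=> uS vS wu wv.
  case: (cases u uS wu) (cases v vS wv) => [[-> b0]|[x -> bx]] [[-> b0']|[y -> by_]] //.
  - by move: by_ => /eqP; rewrite b0 mul0r eq_sym oppr_eq0 oner_eq0.
  - by move: bx => /eqP; rewrite b0' mul0r eq_sym oppr_eq0 oner_eq0.
  have b0 : b != 0 by apply: contra_eq_neq bx => ->; rewrite mul0r eq_sym oppr_eq0 oner_eq0.
  by rewrite (mulfI b0 (etrans bx (esym by_))).
have self z : z \in inr (Some m) |: S -> perp (inr (Some m)) z -> z = inr (Some m).
  case/setU1P=> [->//|/setU1P[->|/imsetP[x /X0 x0 ->]]].
  - by rewrite /perp /perp_hyp /= !mulr0 mulr1 !addr0 oner_eq0.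
  - by rewrite /perp /perp_hyp /= mul1r !mulr0 mul0r !addr0 (negPf x0).
by move=> uS vS wu wv; rewrite (self u uS wu) (self v vS wv).
Qed.

End EvenOrder.

(** * Odd q *)

Section OddOrder.

Variable F : finFieldType.
Hypothesis oddF : odd #|F|.
Local Open Scope ring_scope.

Let h := (#|F|.-1)./2.

Lemma card_odd_field : #|F| = (2 * h).+1.
Proof. by rewrite /h; move: oddF (finNzRing_gt1 F); lia. Qed.

Lemma expf_pred_card (x : F) : x != 0 -> x ^+ (2 * h) = 1.
Proof.
by move=> x0; apply: (mulfI x0); rewrite -exprS mulr1 -card_odd_field expf_card.
Qed.

Lemma half_pred_card_gt0 : (0 < h)%N.
Proof. by have := finNzRing_gt1 F; rewrite card_odd_field; case: h. Qed.

Lemma two_neq0 : (1 + 1 != 0 :> F).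
Proof.
apply/negP => /eqP e2.
have : (1 : F) *+ #|F| = 0.
  by have := expg_cardG (in_setT (1 : F)); rewrite FinRing.zmodXgE cardsT.
rewrite card_odd_field mulrS mulrnA mulr2n e2 mul0rn addr0 => /eqP.
by rewrite oner_eq0.
Qed.

Lemma card_half_roots : (#|[set a : F | a ^+ h == 1%R]| <= h)%N.
Proof.
rewrite cardE; apply: max_unity_roots half_pred_card_gt0 _ (enum_uniq _).
by apply/allP => a; rewrite mem_enum inE unity_rootE.
Qed.

Definition is_square (a : F) : bool := [exists s : F, s ^+ 2 == a].

(** Nonzero squares are roots of a^h = 1, which has at most h solutions among the 2h nonzero
    elements. *)
Lemma card_nonsquares : (h <= #|[set a | ~~ is_square a]|)%N.
Proof.
have sub : [set: F] \subset 0 |: ([set a : F | a ^+ h == 1%R] :|: [set a | ~~ is_square a]).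
  apply/subsetP => a _; rewrite !inE; have [//|a0] := eqVneq a 0.
  case: (boolP (is_square a)) => [/existsP[s /eqP sa]|]; last by rewrite orbT.
  rewrite -sa -exprM expf_pred_card ?eqxx //.
  by apply: contraNneq a0 => s0; rewrite -sa s0 expr0n.
have := subset_leq_card sub; rewrite cardsT card_odd_field cardsU1.
have := card_half_roots.
have [+ _] := leq_card_setU [set a : F | a ^+ h == 1%R] [set a | ~~ is_square a].
by case: (_ \notin _); lia.
Qed.

(* [a ^+ h] takes a value other than 0 and 1, hence [-1] *)
Lemma sqrtN1 : ~~ odd h -> exists i : F, i ^+ 2 = - 1.
Proof.
move=> hev; have [a] : exists a : F, a \in ~: (0 |: [set a : F | a ^+ h == 1%R]).
  apply/set0Pn; rewrite -card_gt0.
  have := cardsC (0 |: [set a : F | a ^+ h == 1%R]); rewrite card_odd_field.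
  have [+ _] := leq_card_setU [set 0] [set a : F | a ^+ h == 1%R]; rewrite cards1.
  have := card_half_roots; have := half_pred_card_gt0.
  have ar (x b n c : nat) : (0 < x -> b <= x -> n <= 1 + b -> n + c = (2 * x).+1 -> 0 < c)%N.
    by clear; lia.
  exact: ar.
rewrite !inE negb_or => /andP[a0 ah1]; exists (a ^+ h./2).
rewrite -exprM muln2 halfK (negPf hev) subn0.
have := expf_pred_card a0; rewrite mulnC exprM => /eqP.
by rewrite sqrf_eq1 (negPf ah1) /= => /eqP.
Qed.

(** If a^2 = -1 then 1 = a^(2h) = (-1)^h = -1. *)
Lemma no_sqrtN1 (a : F) : odd h -> a ^+ 2 + 1 != 0.
Proof.
move=> hodd; rewrite addr_eq0; apply/negP => /eqP a2.
have a0 : a != 0.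
  by apply: contra_eq_neq a2 => ->; rewrite expr0n eq_sym oppr_eq0 oner_eq0.
have := expf_pred_card a0; rewrite exprM a2 -signr_odd hodd expr1 => /eqP.
by rewrite eq_sym -subr_eq0 opprK (negPf two_neq0).
Qed.

Let P : point F := inl (0, 0).

(** The polar line z = 0 of [P] has the absolute points (1:0:0) and (0:1:0). On the polar line of
    (m:1:0) the conic gives 2m y^2 = z^2, so the point is internal when 2m is a nonsquare. Its
    conjugate is (-m:1:0), again internal as -1 is a square. *)
Lemma hyp_internal_set : ~~ odd h -> exists (I : {set point F}) (inv : point F -> point F),
  [/\ #|pencil_base (@perp_hyp F) P| = 3 /\ (h <= #|I|)%N,
      forall z, z \in I -> perp_hyp P z,
      forall z, z \in I -> internal (@perp_hyp F) z,
      forall z, z \in I -> inv z \in I &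
      forall z, z \in I -> perp_hyp z (inv z)].
Proof.
move=> hev; have [i i2] := sqrtN1 hev.
pose J := [set m : F | ~~ is_square (m + m)].
exists [set inr (Some m) | m in J].
exists (fun z => if z is inr (Some m) then inr (Some (- m)) else z).
split; first split.
- have -> : pencil_base (@perp_hyp F) P = P |: [set inr None; inr (Some 0)].
    apply/setP => z; rewrite !inE; congr (_ || _); rewrite /perp_hyp /=.
    case: z => [[a b]|[m|]] /=; rewrite ?(mul0r, mul1r, mulr0, mulr1, addr0, add0r) ?oner_eq0 ?eqxx //=.
    rewrite -[m in m + m]mul1r -mulrDl mulf_eq0 (negPf two_neq0) /=.
    by apply/eqP/eqP => [->|[->]].
  by rewrite cardsU1 cards2 !inE.
- rewrite card_imset; last by move=> ? ? [].
  apply: leq_trans card_nonsquares _.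
  apply: leq_trans (leq_imset_card (fun m => m + m) J); apply: subset_leq_card.
  apply/subsetP => a; rewrite inE => na; have e : a / (1 + 1) + a / (1 + 1) = a.
    by field; exact: two_neq0.
  by apply/imsetP; exists (a / (1 + 1)); rewrite ?inE e.
- by move=> _ /imsetP[m _ ->]; rewrite /perp_hyp /= !mul0r mulr0 !addr0.
- move=> z /imsetP[m]; rewrite inE => mJ -> w ww; apply: contra mJ => mw.
  move: mw ww; rewrite /perp_hyp /= mul1r mul0r addr0 addr_eq0 => /eqP hx.
  rewrite hx => /eqP e.
  have [y0|y0] := eqVneq (cy w) 0.
    case: (@point_nz _ w) => //; first by rewrite hx y0 mulr0 oppr0.
    move: e; rewrite y0 !mulr0 !mul0r !add0r => /eqP; rewrite mulf_eq0 => /orP[]/eqP //.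
  apply/existsP; exists (cz w / cy w); rewrite expr_div_n; apply/eqP.
  apply: (mulIf (expf_neq0 2 y0)); rewrite divfK ?expf_neq0 //.
  apply/eqP; rewrite -subr_eq0 -[X in _ == X]e; apply/eqP; ring.
- move=> _ /imsetP[m mJ ->]; apply/imsetP; exists (- m) => //.
  move: mJ; rewrite !inE; apply: contra => /existsP[s /eqP s2]; apply/existsP.
  by exists (i * s); rewrite exprMn i2 s2; apply/eqP; ring.
- by move=> _ /imsetP[m mJ ->]; rewrite /perp_hyp /=; apply/eqP; ring.
Qed.

Lemma leq_card_fibre2 (T T' : finType) (f : T -> T') (A : {set T}) :
  (forall x, x \in A -> exists y, [set z in A | f z == f x] \subset [set x; y]) ->
  (#|A| <= 2 * #|[set f x | x in A]|)%N.
Proof.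
move=> fib; rewrite -sum1_card (partition_big_imset f) /= mulnC -sum_nat_const.
apply: leq_sum => _ /imsetP[x xA ->]; have [y sub] := fib x xA.
rewrite sum1dep_card; apply: leq_trans (subset_leq_card sub) _.
by rewrite cards2; case: (_ != _).
Qed.

(** As -1 is a nonsquare, z = 0 has no absolute points, (1:0:0) is internal, and so is (m:1:0) when
    m^2 + 1 is a square. Conjugation sends m to -1/m. *)
Lemma dot_internal_set : odd h -> exists (I : {set point F}) (inv : point F -> point F),
  [/\ #|pencil_base (@perp_dot F) P| = 1 /\ (h < #|I|)%N,
      forall z, z \in I -> perp_dot P z,
      forall z, z \in I -> internal (@perp_dot F) z,
      forall z, z \in I -> inv z \in I &
      forall z, z \in I -> perp_dot z (inv z)].
Proof.
move=> hodd; have nsq := no_sqrtN1 ^~ hodd.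
have sum_sq (a b : F) : a ^+ 2 + b ^+ 2 = 0 -> a = 0 /\ b = 0.
  have [-> /eqP|b0] := eqVneq b 0.
    by rewrite expr0n addr0 expf_eq0 /= => /eqP.
  move=> e; have := nsq (a / b); rewrite expr_div_n => /eqP; case.
  by apply: (mulIf (expf_neq0 2 b0)); rewrite mulrDl divfK ?expf_neq0 // mul1r mul0r.
pose J := [set m : F | is_square (m ^+ 2 + 1)].
exists (inr None |: [set inr (Some m) | m in J]).
exists (fun z => match z with inr None => inr (Some 0)
  | inr (Some m) => if m == 0 then inr None else inr (Some (- m^-1))
  | _ => z end).
have J0 : 0 \in J by rewrite inE; apply/existsP; exists 1; rewrite expr1n expr0n add0r.
have cases (Q : point F -> Prop) : Q (inr None) ->
    (forall m, m \in J -> Q (inr (Some m))) ->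
    forall z, z \in inr None |: [set inr (Some m) | m in J] -> Q z.
  by move=> Q0 Q1 z /setU1P[->|/imsetP[m mJ ->]] //; apply: Q1.
split; first split.
- have -> : pencil_base (@perp_dot F) P = [set P].
    apply/setP => z; rewrite !inE orbC; case: eqP => [_|_]; first by rewrite orbT.
    rewrite orbF /perp_dot /=; apply/negP => /andP[].
    case: z => [[a b]|[m|]] /=; rewrite ?(mul0r, mul1r, mulr0, mulr1, addr0, add0r) ?oner_eq0 //.
    by move=> _; rewrite -expr2 (negPf (nsq m)).
  by rewrite cards1.
- rewrite cardsU1 card_imset; last by move=> ? ? [].
  rewrite (_ : inr None \in _ = false); last by apply/imsetP => -[].
  rewrite add1n ltnS -(leq_pmul2l (m := 2)) //.
  have two := two_neq0.
  have <- : #|[set~ (0 : F)]| = (2 * h)%N by rewrite cardsC1 card_odd_field.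
  (* If m = (u - 1/u)/2 then m^2 + 1 = ((u + 1/u)/2)^2, and [f] takes each value at most twice, at x
     and -1/x. *)
  pose f u : F := (u - u^-1) / (1 + 1).
  apply: leq_trans (_ : (2 * #|[set f u | u in [set~ 0%R]]| <= _)%N).
    apply: leq_card_fibre2 => x; rewrite !inE => x0; exists (- x^-1).
    apply/subsetP => z; rewrite !inE => /andP[z0 /eqP e].
    rewrite -subr_eq0 -[z == _]subr_eq0 -mulf_eq0 opprK; apply/eqP.
    transitivity (z * (1 + 1) * (f z - f x)); last by rewrite e subrr mulr0.
    by rewrite /f; field; rewrite x0 z0 two.
  rewrite leq_pmul2l //; apply: subset_leq_card; apply/subsetP => z /imsetP[u].
  rewrite !inE => u0 ->; apply/existsP; exists ((u + u^-1) / (1 + 1)).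
  by apply/eqP; rewrite /f; field; rewrite u0 two.
- by apply: cases => [|m _]; rewrite /perp_dot /= ?mul0r !mulr0 !addr0.
- apply: cases => [|m mJ] w ww; apply/negP; rewrite /perp_dot /= ?(mul0r, mul1r, addr0) => /eqP hx.
    have [] := sum_sq (cy w) (cz w); last by apply: point_nz.
    by move: ww; rewrite /perp_dot hx mul0r add0r -!expr2 => /eqP.
  move: mJ; rewrite inE => /existsP[n /eqP n2].
  have hy : cy w = - (m * cx w) by apply/eqP; rewrite -addr_eq0 addrC; apply/eqP.
  have [] := sum_sq (n * cx w) (cz w).
    move: ww; rewrite /perp_dot => /eqP <-; rewrite exprMn n2 hy; ring.
  move=> /eqP; rewrite mulf_eq0 => /orP[/eqP n0|/eqP x0] z0.
    by move: (nsq m); rewrite -n2 n0 expr0n eqxx.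
  by apply: (point_nz x0) => //; rewrite hy x0 mulr0 oppr0.
- apply: cases => [|m mJ]; first by rewrite !inE imset_f ?orbT.
  have [_|m0] := eqVneq m 0; first by rewrite setU11.
  rewrite in_setU imset_f ?orbT // inE.
  move: mJ; rewrite inE => /existsP[n /eqP n2]; apply/existsP; exists (n / m).
  by rewrite expr_div_n n2; apply/eqP; field.
- apply: cases => [|m mJ]; first by rewrite /perp_dot /=; apply/eqP; ring.
  have [->|m0] := eqVneq m 0; rewrite /perp_dot /=; apply/eqP; first by ring.
  by field.
Qed.

(** The base uses 3 points. Odd m needs m - 3 <= h, even m needs m <= h; as h is even, the exception
    is m = h + 2. *)
Lemma odd_graph1 (m : nat) : ~~ odd h -> (3 <= m <= h + 3)%N -> (m != h + 2)%N ->
  C4free_min_degree #|F| (#|F| ^ 2 + #|F| + 1 - m).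
Proof.
move=> hev /andP[m3 mh] mne.
have [I [inv [[c3 cI] Ip Iint invI pinv]]] := hyp_internal_set hev.
rewrite -card_point; have [mo|me] := boolP (odd m).
  have -> : m = (#|pencil_base (@perp_hyp F) P| + 2 * ((m - 3)./2))%N by rewrite c3; lia.
  apply: (pencil_graph_even (@perp_hyp_sym F) (@perp_hyp_uniq F) (@perp_hyp_deg F) Ip Iint invI pinv).
  by lia.
have -> : m = (#|pencil_base (@perp_hyp F) P| + 2 * ((m - 4)./2) + 1)%N by rewrite c3; lia.
apply: (pencil_graph_odd (@perp_hyp_sym F) (@perp_hyp_uniq F) (@perp_hyp_deg F) Ip Iint invI pinv).
by lia.
Qed.

(** The base is [P] alone and |I| >= h + 1. Odd m needs m <= h + 2, even m needs m + 2 <= h + 1; as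
    h is odd, the exception is m = h + 1. *)
Lemma odd_graph3 (m : nat) : odd h -> (2 <= m <= h + 2)%N -> (m != h + 1)%N ->
  C4free_min_degree #|F| (#|F| ^ 2 + #|F| + 1 - m).
Proof.
move=> hodd /andP[m2 mh] mne.
have [I [inv [[c1 cI] Ip Iint invI pinv]]] := dot_internal_set hodd.
rewrite -card_point; have [mo|me] := boolP (odd m).
  have -> : m = (#|pencil_base (@perp_dot F) P| + 2 * ((m - 1)./2))%N by rewrite c1; lia.
  apply: (pencil_graph_even (@perp_dot_sym F) (@perp_dot_uniq F) (@perp_dot_deg F) Ip Iint invI pinv).
  by lia.
have -> : m = (#|pencil_base (@perp_dot F) P| + 2 * ((m - 2)./2) + 1)%N by rewrite c1; lia.
apply: (pencil_graph_odd (@perp_dot_sym F) (@perp_dot_uniq F) (@perp_dot_deg F) Ip Iint invI pinv).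
by lia.
Qed.

End OddOrder.

(** * The numerical gap and the assembly *)

Lemma Qbound_gap (R : realType) (k : nat) (eps : R) (q t : nat) :
  3 <= k -> (0 < eps)%R -> (eps < 1)%R -> (Qbound k eps <= q%:R)%R ->
  (t%:R <= (1 - eps) * q%:R)%R -> t + 20 * k ^ 4 <= q.
Proof.
move=> k3 e0 e1 hQ ht; rewrite -(ler_nat R) natrD.
suff h : ((20 * k ^ 4)%:R <= eps * q%:R)%R.
  apply: le_trans (lerD ht h) _; rewrite mulrBl mul1r subrK; exact: lexx.
(* It remains to bound eps Q from below: it is at least (320k^4)^(k+1), since eps^(2k) <= eps, and
   so at least 20k^4. *)
apply: le_trans (ler_wpM2l (ltW e0) hQ); rewrite /Qbound.
have A1 : (1 <= 320%:R * k%:R ^+ 4 :> R)%R.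
  by rewrite -natrX -natrM ler1n muln_gt0 expn_gt0; lia.
apply: (@le_trans _ _ (320%:R * k%:R ^+ 4)%R).
  by rewrite natrM natrX ler_wpM2r ?exprn_ge0 ?ler_nat.
apply: (@le_trans _ _ ((320%:R * k%:R ^+ 4) ^+ k.+1)%R); first by rewrite ler_eXnr.
have := exprn_ge0 k.+1 (le_trans ler01 A1).
move: ((320%:R * k%:R ^+ 4) ^+ k.+1)%R => A A0; rewrite mulrCA.
apply: ler_peMr => //; rewrite ler_pdivlMr ?exprn_gt0 // mul1r.
by apply: ler_iXnr; rewrite ?ltW //; lia.
Qed.

Theorem theorem1p6 (R : realType) (k : nat) (eps : R)
    (hk : 3 <= k) (heps0 : (0 < eps)%R) (heps1 : (eps < 1)%R) :
  (forall q t : nat,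
     (Qbound k eps <= q%:R)%R -> prime_power q -> ~~ odd q ->
     0 <= t -> (t%:R <= (1 - eps) * q%:R)%R -> t <> 1 ->
     is_ramsey_number C4 (book k (book_size k q t)) (q ^ 2 + t))
  /\
  (forall q t : nat,
     (Qbound k eps <= q%:R)%R -> prime_power q -> odd q ->
     (q = 3 %[mod 4] /\ (q + 1) %/ 2 <= t /\
        (t%:R <= (1 - eps) * q%:R)%R /\ t <> (q + 3) %/ 2)
     \/
     (q = 1 %[mod 4] /\ (q - 1) %/ 2 <= t /\
        (t%:R <= (1 - eps) * q%:R)%R /\ t <> (q + 1) %/ 2) ->
     is_ramsey_number C4 (book k (book_size k q t)) (q ^ 2 + t)).
Proof.
have k4 : 0 < 20 * k ^ 4 by rewrite muln_gt0 expn_gt0; lia.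
split=> q t hQ [p [n [pr_p n0 qE]]].
  move=> qev _ ht t1; have gap := Qbound_gap hk heps0 heps1 hQ ht.
  have p2 : p = 2.
    by case: (even_prime pr_p) => // po; move: qev; rewrite qE oddX po orbT.
  have [F Fp cF] := pPrimePowerField pr_p n0.
  have char2 : (1 + 1 = 0 :> F)%R.
    by have := pcharf0 Fp; rewrite p2.
  have qF : q = #|F| by rewrite cF.
  apply: (is_ramsey_number_book hk (leqnn _) gap); first by lia.
  have [->|t0] := posnP t.
    by rewrite addn0 qF -subn1; apply: even_graph_small.
  (* Here t >= 2, so n = q + 1 - t is below q as [even_graph] demands. *)
  have -> : (q ^ 2 + t).-1 = q ^ 2 + q - (q + 1 - t) by lia.
  by rewrite qF; apply: even_graph => //; rewrite -qF; lia.
move=> qodd hyp; have [F Fp cF] := pPrimePowerField pr_p n0.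
have qF : q = #|F| by rewrite cF.
have ht : (t%:R <= (1 - eps) * q%:R)%R by case: hyp => [[_ [_ []]]|[_ [_ []]]].
have gap := Qbound_gap hk heps0 heps1 hQ ht.
apply: (is_ramsey_number_book hk (leqnn _) gap); first by lia.
(* With m = q + 2 - t and h = (q - 1)/2, the lower bounds on t become m <= h + 2 and m <= h + 3, and
   the excluded values of t become m = h + 1 and m = h + 2, for q = 3 and q = 1 mod 4
   respectively. *)
have -> : (q ^ 2 + t).-1 = q ^ 2 + q + 1 - (q + 2 - t) by lia.
case: hyp => [[q3 [tq [_ tne]]]|[q1 [tq [_ tne]]]].
  by rewrite {1 2 3}qF; apply: odd_graph3; rewrite -qF //; lia.
by rewrite {1 2 3}qF; apply: odd_graph1; rewrite -qF //; lia.
Qed.
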